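(* Let $n\ge 1$ and let $\mu$ be a partition with at most $n$ parts. Then the interpolation Macdonald polynomial $I_\mu(x_1,\dots,x_n;q,t,s)$ is given by $$ I_\mu=\sum_{f} \Psi_f \prod_{\square\in\mu} \left(x_{f(\square)} - \frac{s\, q^{\mathrm{col}(\square)}}{t^{f(\square)+\mathrm{row}(\square)}} -\frac{t^{f(\square)+\mathrm{row}(\square)}}{s\, q^{\mathrm{col}(\square)}}\right), $$ where the sum is over all reverse tableaux $f:\mu\to\{1,\dots,n\}$.
   Context: $q,t,s$ are independent indeterminates. A partition is identified with its diagram, whose squares $\square$ have row number $\mathrm{row}(\square)$ and column number $\mathrm{col}(\square)$, both starting from $1$; the $i$-th row of $\mu$ has $\mu_i$ squares, row 1 on top. $|\mu|=\sum\mu_i$, $\ell(\mu)$ is the number of nonzero parts, and $\mu\subset\lambda$ means containment of diagrams. Interpolation Macdonald polynomials. For a partition $\mu$ with at most $n$ parts, $I_\mu=I_\mu(x_1,\dots,x_n;q,t,s)\in\mathbb{Q}(q,t,s)[x_1,\dots,x_n]^{S(n)}$ is the nonzero symmetric polynomial of degree at most $|\mu|$ such that $I_\mu([1,\lambda_1],\dots,[n,\lambda_n])=0$ for every partition $\lambda=(\lambda_1\ge\dots\ge\lambda_n\ge 0)$ with $\mu\not\subset\lambda$, where $$[i,j]=\frac{sq^{j+1}}{t^{i+1}}+\frac{t^{i+1}}{sq^{j+1}}.$$ These conditions determine $I_\mu$ uniquely up to a constant factor; it is normalized so that its homogeneous component of degree $|\mu|$ is the ordinary Macdonald polynomial $P_\mu(x_1,\dots,x_n;q,t)$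 (the coefficient of $x_1^{\mu_1}\cdots x_n^{\mu_n}$ is $1$). Reverse tableaux. A function $f$ from the squares of $\mu$ to $\{1,\dots,n\}$ is a reverse tableau if its values weakly decrease along the rows (left to right) and strictly decrease along the columns (top to bottom). Weights. For a reverse tableau $f$ on $\mu$, put $\mu^{(k)}=f^{-1}(\{k+1,\dots,n\})$ for $k=0,\dots,n$, so $\mu=\mu^{(0)}\supset\mu^{(1)}\supset\dots\supset\mu^{(n)}=\emptyset$ are diagrams of partitions and each $\mu^{(k)}/\mu^{(k+1)}$ is a horizontal strip. Then $\Psi_f=\prod_{k=0}^{n-1}\psi_{\mu^{(k)}/\mu^{(k+1)}}$, where for a horizontal strip $\lambda/\nu$ $$ \psi_{\lambda/\nu}=\prod_{1\le i\le j\le \ell(\nu)}\frac{\phi(q^{\nu_i-\nu_j}t^{j-i})\,\phi(q^{\lambda_i-\lambda_{j+1}}t^{j-i})}{\phi(q^{\lambda_i-\nu_j}t^{j-i})\,\phi(q^{\nu_i-\lambda_{j+1}}t^{j-i})},\qquad \phi(u)=\prod_{m\ge 0}\frac{1-tuq^m}{1-q^{m+1}u}. $$ Equivalently, as a finite product, $$ \psi_{\lambda/\nu}=\prod_{1\le i\le j\le \ell(\nu)}\ \prod_{k=0}^{\lambda_i-\nu_i-1}\frac{(1-q^{\nu_i-\nu_j+k}t^{j-i+1})(1-q^{\nu_i-\lambda_{j+1}+k+1}t^{j-i})}{(1-q^{\nu_i-\nu_j+k+1}t^{j-i})(1-q^{\nu_i-\lambda_{j+1}+k}t^{j-i+1})}\in\mathbb{Q}(q,t).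 $$ *)

(* Defs.v *)
From HB Require Import structures.
From mathcomp Require Import all_boot all_order all_algebra.
From mathcomp.multinomials Require Import mpoly.

Set Implicit Arguments.
Unset Strict Implicit.
Unset Printing Implicit Defensive.

Import GRing.Theory.
Local Open Scope ring_scope.

(* The field Q(q,t,s). *)
Definition Qqts : fieldType := {fraction {mpoly rat[3]}}.
Definition q : Qqts := FracField.tofrac 'X_(inord 0).
Definition t : Qqts := FracField.tofrac 'X_(inord 1).
Definition s : Qqts := FracField.tofrac 'X_(inord 2).

(* A partition with at most n parts is a weakly decreasing 'X_{1..n}; then    *)
(* mdeg mu is |mu|, (mu <= lam)%MM is the containment of diagrams, and 'X_[mu] *)
(* is x_1^{mu_1} ... x_n^{mu_n}.                                              *)
Definition is_partition n (mu : 'X_{1..n}) : Prop :=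
  forall i j : 'I_n, (i <= j)%N -> (mu j <= mu i)%N.

(* Parts numbered from 1, equal to 0 beyond n. Only used with i >= 1. *)
Definition part n (mu : 'X_{1..n}) (i : nat) : nat := nth 0%N mu i.-1.

Definition plength n (mu : 'X_{1..n}) : nat := #|[pred i : 'I_n | (0 < mu i)%N]|.

(* [i, j], with i >= 1. *)
Definition bracket (i j : nat) : Qqts :=
  s * q ^+ j.+1 / t ^+ i.+1 + t ^+ i.+1 / (s * q ^+ j.+1).

(* The conditions that determine I_mu up to a constant factor. *)
Definition interpolation_conditions n (mu : 'X_{1..n}) (p : {mpoly Qqts[n]}) :
    Prop :=
  [/\ p != 0,
      p \is symmetric,
      (msize p <= (mdeg mu).+1)%N
    & forall lam : 'X_{1..n}, is_partition lam -> ~~ (mu <= lam)%MM ->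
        p.@[fun i : 'I_n => bracket i.+1 (lam i)] = 0].

(* p is I_mu. *)
Definition is_interpolation_Macdonald n (mu : 'X_{1..n}) (p : {mpoly Qqts[n]}) :
    Prop :=
  interpolation_conditions mu p /\ p@_mu = 1.

(* Squares of the diagram; the two components are row - 1 and column - 1. *)
Definition square n (mu : 'X_{1..n}) : finType := {i : 'I_n & 'I_(mu i)}.

Definition sqrow n (mu : 'X_{1..n}) (a : square mu) : nat := (tag a).+1.

Definition sqcol n (mu : 'X_{1..n}) (a : square mu) : nat := (tagged a).+1.

(* f a : 'I_n stands for the value (f a).+1 in {1, ..., n}. *)
Definition reverse_tableau n (mu : 'X_{1..n}) (f : {ffun square mu -> 'I_n}) :
    bool :=
  [forall a, forall b,
     ((sqrow a == sqrow b) && (sqcol a <= sqcol b)%N ==> (f b <= f a)%N) &&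
     ((sqcol a == sqcol b) && (sqrow a < sqrow b)%N ==> (f b < f a)%N)].

(* mu^(k), the diagram of the squares whose value (f a).+1 is at least k + 1, *)
(* given by its row lengths.                                                  *)
Definition level n (mu : 'X_{1..n}) (f : {ffun square mu -> 'I_n}) (k : nat) :
    'X_{1..n} :=
  [multinom #|[pred a : square mu | (tag a == i) && (k <= f a)%N]| | i < n].

(* psi_{lam/nu}, where the infinite products phi have been cancelled in pairs. *)
(* When lam/nu is a horizontal strip and i <= j <= l(nu), no subtraction below *)
(* is truncated and no denominator vanishes.                                  *)
Definition psi n (lam nu : 'X_{1..n}) : Qqts :=
  \prod_(1 <= j < (plength nu).+1) \prod_(1 <= i < j.+1)
  \prod_(0 <= k < part lam i - part nu i)
    (((1 - q ^+ (part nu i - part nu j + k) * t ^+ (j - i + 1))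
      * (1 - q ^+ (part nu i - part lam j.+1 + k + 1) * t ^+ (j - i)))
     / ((1 - q ^+ (part nu i - part nu j + k + 1) * t ^+ (j - i))
      * (1 - q ^+ (part nu i - part lam j.+1 + k) * t ^+ (j - i + 1)))).

Definition Psi n (mu : 'X_{1..n}) (f : {ffun square mu -> 'I_n}) : Qqts :=
  \prod_(k < n) psi (level f k) (level f k.+1).

(* Main.v *)
Require Import Defs.
From HB Require Import structures.
From mathcomp Require Import all_boot all_order all_algebra.
From mathcomp Require Import fingroup perm.
From mathcomp.multinomials Require Import mpoly.
From mathcomp Require Import ring zify.

Set Implicit Arguments.
Unset Strict Implicit.
Unset Printing Implicit Defensive.

Import GRing.Theory.
Local Open Scope ring_scope.

(** The sum over reverse tableaux is computed by peeling off the squares of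
    value 1, then those of value 2, and so on: it is a product of transfer
    operators [transfer s x], whose entry at (la, nu) is
    psi_{la/nu} prod_{(i,j) in la/nu} (x - [i,j-1]).

    The vanishing conditions and the leading term can be read off the formula;
    the difficulty is the symmetry in x_1, ..., x_n, that is,
    transfer s x * transfer (s/t) y = transfer s y * transfer (s/t) x.
    The operator [pieri s], which is multiplication by x_1 + ... + x_n in the
    basis of interpolation polynomials (diagonal term e(la) = sum_i [i,la_i],
    off-diagonal terms given by adding one square), satisfies
    pieri s * transfer s x = transfer s x * (x - const + pieri (s/t)); entry by
    entry this is the residue theorem for the rational function
      prod_i (z - (t/q) l_i)/(z - l_i) prod_j (z - n_j/t)/(z - n_j/q),
    with l_i = q^{la_i} t^{-i} and n_j = q^{nu_j} t^{-j}.
    Applied to both orders of x and y at la - e_1, this relation expresses the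
    commutator at la by commutators at smaller diagrams or at diagrams of the
    same size with a shorter first row. The induction stops when
    la_1 = la_2, and then the first row can be stripped: the product of the two
    transfer operators reduces to the same product for shorter partitions,
    times a factor symmetric in x and y.

    Uniqueness: the leading monomial of the tableau sum attached to mu is x^mu,
    so these sums span the symmetric polynomials; the sum for ka vanishes at
    the point of la unless ka is contained in la, and not at the point of ka. *)

(** * Partial fractions *)

(** Lagrange interpolation at the points [b i]: both sides are the coefficient of degree |I| - 1 of
    prod_j (z - a_j) - prod_j (z - b_j), whose value at [b i] is prod_j (b_i - a_j). *)
Lemma sum_residues (K : fieldType) (I : finType) (a b : I -> K) :
  injective b ->
  \sum_i (\prod_j (b i - a j)) / (\prod_(j | j != i) (b i - b j))
    = \sum_i b i - \sum_i a i.
Proof.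
move=> b_inj.
pose P (c : I -> K) : {poly K} := \prod_j ('X - (c j)%:P).
pose Q i : {poly K} := \prod_(j | j != i) ('X - (b j)%:P).
pose r i := (\prod_j (b i - a j)) / (\prod_(j | j != i) (b i - b j)).
have PE c : P c = \prod_(z <- map c (enum I)) ('X - z%:P).
  by rewrite big_map big_enum.
have horP c z : (P c).[z] = \prod_j (z - c j).
  by rewrite horner_prod; apply: eq_bigr => j _; rewrite hornerXsubC.
have horQ i z : (Q i).[z] = \prod_(j | j != i) (z - b j).
  by rewrite horner_prod; apply: eq_bigr => j _; rewrite hornerXsubC.
have sizeP c : size (P c) = #|I|.+1.
  by rewrite PE size_prod_XsubC size_map -cardE.
have monP c : P c \is monic by rewrite monic_prod_XsubC.
have monQ i : Q i \is monic by rewrite monic_prod_XsubC.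
have sizeQ i : size (Q i) = #|I|.
  have := sizeP b; rewrite /P (bigD1 i) //= -/(Q i) size_Mmonic ?polyXsubC_eq0 //.
    by rewrite size_XsubC /= => -[].
have coefP c : I -> (P c)`_(#|I|.-1) = - \sum_i c i.
  move=> i0; have := @coefPn_prod_XsubC K (map c (enum I)).
  rewrite size_map -cardE -PE => ->; first by rewrite big_map big_enum.
  by rewrite -lt0n; apply/card_gt0P; exists i0.
case: (pickP I) => [i0 _|I0]; last by rewrite !big_pred0 ?subr0 // => i; have := I0 i.
have I_gt0 : (0 < #|I|)%N by apply/card_gt0P; exists i0.
pose g := P a - P b - \sum_i r i *: Q i.
have size_g : (size g <= #|I|)%N.
  rewrite /g (leq_trans (size_polyD _ _)) // size_polyN geq_max; apply/andP; split.
    have s1 : (size (P a - P b)%R <= #|I|.+1)%N.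
      by rewrite (leq_trans (size_polyD _ _)) // size_polyN !sizeP maxnn.
    rewrite -ltnS ltn_neqAle s1 andbT; apply/eqP => s2.
    have := lead_coef_eq0 (P a - P b); rewrite -size_poly_eq0 s2 /= /lead_coef s2 /=.
    rewrite coefB.
    have:= monicP (monP a); have:= monicP (monP b); rewrite /lead_coef !sizeP /= => -> ->.
    by rewrite subrr eqxx.
  apply: (big_ind (fun p : {poly K} => (size p <= #|I|)%N)); first by rewrite size_poly0.
    by move=> p1 p2 h1 h2; rewrite (leq_trans (size_polyD _ _)) // geq_max h1.
  by move=> i _; rewrite (leq_trans (size_scale_leq _ _)) // sizeQ.
have g0 : g = 0.
  apply: (@roots_geq_poly_eq0 _ _ (map b (enum I))).
  - apply/allP => _ /mapP [k _ ->]; rewrite /root /g !(hornerD, hornerN) !horP.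
    rewrite (bigD1 k _ (F := fun j => b k - b j)) //= subrr mul0r subr0.
    rewrite horner_sum [in X in - X](bigD1 k) //= [X in - (_ + X)]big1 ?addr0; last first.
      move=> j jk; rewrite hornerZ horQ (bigD1 k _ (F := fun j => b k - b j)) 1?eq_sym //=.
      by rewrite subrr mul0r mulr0.
    rewrite hornerZ horQ /r divfK ?subrr //.
    by apply/prodf_neq0 => j jk; rewrite subr_eq0 (inj_eq b_inj) eq_sym.
  - by rewrite map_inj_uniq ?enum_uniq.
  - by rewrite size_map -cardE.
have := congr1 (fun p : {poly K} => p`_(#|I|.-1)) g0.
rewrite /g !coefB coef0 !coefP // coef_sum.
under [X in _ - X]eq_bigr => i _.
  have := monicP (monQ i); rewrite /lead_coef sizeQ => Qc.
  rewrite coefZ Qc mulr1; over.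
move/eqP; rewrite subr_eq0 => /eqP <-.
by rewrite opprK addrC.
Qed.

(** [sum_residues] with an extra pole at 0 and an extra zero at 1: the residue at 0 produces the
    quotient of the two products. *)
Lemma sum_residues_div (K : fieldType) (I : finType) (a b : I -> K) :
  injective b -> (forall i, b i != 0) ->
  \sum_i (\prod_j (b i - a j)) / (\prod_(j | j != i) (b i - b j)) / b i
    = 1 - (\prod_i a i) / (\prod_i b i).
Proof.
move=> b_inj b0.
pose b' (i : I + unit) : K := if i is inl j then b j else 0.
pose a' (i : I + unit) : K := if i is inl j then a j else 1.
have b'_inj : injective b'.
  by move=> [i|[]] [j|[]] //= => [/b_inj->//|/eqP|/esym/eqP]; rewrite ?(negPf (b0 _)).
have sumu (F : unit -> K) : \sum_i F i = F tt.
  by rewrite (big_pred1 tt) // => -[].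
have produ (F : unit -> K) : \prod_i F i = F tt.
  by rewrite (big_pred1 tt) // => -[].
have sgn (c : I -> K) : \prod_j (0 - c j) = (-1) ^+ #|I| * \prod_j c j.
  by rewrite -prodr_const -big_split /=; apply: eq_bigr => j _; rewrite sub0r mulN1r.
have := sum_residues a' b'_inj; rewrite !big_sumType /= !sumu /= addr0.
under eq_bigr => i _.
  rewrite !big_sumType /= !produ /= subr0.
  rewrite [in X in _ / X](eq_bigl (fun j => j != i)); last by move=> j;
    rewrite (inj_eq inl_inj).
  over.
rewrite !big_sumType /= produ /= [X in _ / (_ * X)]big_pred0; last by case.
rewrite mulr1 sgn [\prod_(i | inl i != inr tt :> I + unit) _](eq_bigl xpredT) // sgn => E.
have R0 := sum_residues a b_inj.
have {E} : \sum_i \prod_j (b i - a j) / \prod_(j | j != i) (b i - b j)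
  - \sum_i (\prod_j (b i - a j)) / (\prod_(j | j != i) (b i - b j)) / b i
   - (\prod_i a i) / (\prod_i b i) = \sum_i b i - (\sum_i a i + 1).
  rewrite -E -sumrB; congr (_ + _).
    apply: eq_bigr => i _; set X := (\prod_(j | j != i) _).
    have X0 : X != 0.
      by apply/prodf_neq0 => j jk; rewrite subr_eq0 (inj_eq b_inj) eq_sym.
    by field; rewrite X0 b0.
  have h2 : \prod_i b i != 0 by apply/prodf_neq0.
  have h1 : (-1) ^+ #|I| != 0 :> K by rewrite signr_eq0.
  by field; rewrite h1 h2.
rewrite R0 => E.
apply/eqP; rewrite -subr_eq0; apply/eqP.
have := congr1 (fun z => \sum_i b i - (\sum_i a i + 1) - z) E; rewrite /= [RHS]subrr => E2;
  rewrite -[RHS]E2; ring.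
Qed.

(** [sum_residues] applied to the inverses of all points. *)
Lemma sum_residues_div2 (K : fieldType) (I : finType) (a b : I -> K) :
  injective b -> (forall i, b i != 0) -> (forall i, a i != 0) ->
  \sum_i (\prod_j (b i - a j)) / (\prod_(j | j != i) (b i - b j)) / b i ^+ 2
    = (\prod_i a i) / (\prod_i b i) * (\sum_i (a i)^-1 - \sum_i (b i)^-1).
Proof.
move=> b_inj b0 a0.
have bV_inj : injective (fun i => (b i)^-1) by move=> i j /invr_inj/b_inj.
have pb0 : \prod_i b i != 0 by apply/prodf_neq0.
have pa0 : \prod_i a i != 0 by apply/prodf_neq0.
rewrite -opprB -(sum_residues (fun i => (a i)^-1) bV_inj) -sumrN mulr_sumr.
apply: eq_bigr => i _.
have -> : \prod_j ((b i)^-1 - (a j)^-1)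
    = (\prod_j (b i - a j)) * (-1) ^+ #|I| / (b i ^+ #|I| * \prod_j a j).
  rewrite -!prodr_const -!big_split /= -prodfV -big_split /=.
  by apply: eq_bigr => j _; field; rewrite b0 a0.
have -> : \prod_(j | j != i) ((b i)^-1 - (b j)^-1)
    = (\prod_(j | j != i) (b i - b j)) * (-1) ^+ #|I| * - b i ^+ 2 / (b i ^+ #|I| * \prod_j b j).
  rewrite -!prodr_const [\prod_(i0 in I) -1](bigD1 i) //= [\prod_(i0 in I) b _](bigD1 i) //=.
  rewrite [\prod_j b j](bigD1 i) //=.
  set A := \prod_(j | _) (b i - b j); set B := \prod_(i0 | _) -1.
  set C := \prod_(i0 | _) b i; set D := \prod_(i0 | _) b i0.
  have -> : A * (-1 * B) * - b i ^+ 2 / (b i * C * (b i * D)) = A * B / (C * D).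
    have C0 : C != 0 by apply/prodf_neq0.
    have D0 : D != 0 by apply/prodf_neq0.
    by field; rewrite C0 D0 b0.
  rewrite -big_split /= -big_split -prodfV -big_split /=.
  by apply: eq_bigr => j _; field; rewrite b0 b0.
set X := (\prod_(j | j != i) _).
have X0 : X != 0.
  by apply/prodf_neq0 => j jk; rewrite subr_eq0 (inj_eq b_inj) eq_sym.
have b2 := b0 i.
have s0 : (-1) ^+ #|I| != 0 :> K by rewrite signr_eq0.
have bi0 : b i ^+ #|I| != 0 by rewrite expf_neq0.
by field; rewrite X0 s0 bi0 pa0 pb0 oppr_eq0 sqrf_eq0 b2.
Qed.

(* With f the rational function above, [pieri_up p] and [- pieri_down p] are the
   residues of f(z) / ((1 - t/q) z) at z = l_p and z = n_p / q. *)
Section PieriSums.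
Variables (K : fieldType) (q t : K) (N : nat) (l : 'I_N.+1 -> K) (n : 'I_N -> K).
Hypotheses (q0 : q != 0) (t0 : t != 0) (qt : q != t).
Hypotheses (l0 : forall i, l i != 0) (n0 : forall i, n i != 0).
Hypotheses (l_inj : injective l) (n_inj : injective n).
Hypothesis (ln : forall i j, l i != n j / q).

Definition pieri_up p :=
  (\prod_(i | i != p) ((l p - t / q * l i) / (l p - l i)))
  * \prod_j ((l p - n j / t) / (l p - n j / q)).

Definition pieri_down p :=
  q / t * (\prod_i ((n p / q - t / q * l i) / (n p / q - l i)))
  * \prod_(j | j != p) ((n p / q - n j / t) / (n p / q - n j / q)).

(** Zeros [a] and poles [b] of the rational function f; [R i] is its residue at [b i]. *)
Let a (i : 'I_N.+1 + 'I_N) := match i with inl i => t / q * l i | inr j => n j / t end.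
Let b (i : 'I_N.+1 + 'I_N) := match i with inl i => l i | inr j => n j / q end.
Let R i := (\prod_j (b i - a j)) / (\prod_(j | j != i) (b i - b j)).

Let RE i : R i = (b i - a i) * \prod_(j | j != i) ((b i - a j) / (b i - b j)).
Proof. by rewrite /R (bigD1 i) //= -mulrA -prodfV -big_split. Qed.

Let R_inl p : R (inl p) = (1 - t / q) * l p * pieri_up p.
Proof.
rewrite RE big_sumType /= (eq_bigl (fun j => j != p)); last first.
  by move=> j; rewrite (inj_eq inl_inj).
by rewrite /pieri_up !mulrA; congr (_ * _ * _); ring.
Qed.

Let R_inr p : R (inr p) = - (1 - t / q) * (n p / q) * pieri_down p.
Proof.
rewrite RE big_sumType /= [X in _ * (_ * X)](eq_bigl (fun j => j != p)); last first.
  by move=> j; rewrite (inj_eq inr_inj).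
rewrite /pieri_down !mulrA; congr (_ * _ * _).
by field; rewrite q0 t0.
Qed.

Let b_inj : injective b.
Proof.
move=> [i|i] [j|j] /= => [/l_inj->//|/eqP|/esym/eqP|/(mulIf (invr_neq0 q0))/n_inj->//].
  by rewrite (negPf (ln _ _)).
by rewrite (negPf (ln _ _)).
Qed.

Let b0 i : b i != 0.
Proof. by case: i => i //=; rewrite mulf_neq0 ?invr_neq0. Qed.

Let a0 i : a i != 0.
Proof. by case: i => i /=; rewrite !mulf_neq0 ?invr_neq0. Qed.

(** There is one more point l_i than there are points n_j, so a single factor t/q survives. This is
    where the normalization by 1 - t/q comes from. *)
Let quot0 : (\prod_i a i) / (\prod_i b i) = t / q.
Proof.
rewrite -prodfV -big_split /= big_sumType /=.
under eq_bigr => i _ do rewrite mulfK //.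
rewrite prodr_const card_ord.
under eq_bigr => i _.
  have -> : n i / t / (n i / q) = q / t by field; rewrite q0 t0 n0.
  over.
rewrite prodr_const card_ord exprS -mulrA -exprMn.
have -> : t / q * (q / t) = 1 by field; rewrite q0 t0.
by rewrite expr1n mulr1.
Qed.

Let qt' : 1 - t / q != 0.
Proof. by rewrite subr_eq0; apply/eqP => E; case/eqP: qt;
  rewrite -[t](divfK q0) -E mul1r. Qed.

(** This identity and the next two are the residue sums of f(z)/z, f(z) and f(z)/z^2, divided by 1 -
    t/q. *)
Let sum_pieri0 : \sum_p pieri_up p - \sum_p pieri_down p = 1.
Proof.
apply: (mulfI qt'); have := sum_residues_div a b_inj b0.
rewrite quot0 big_sumType /= => E; rewrite mulr1 -[RHS]E.
rewrite mulrBr !mulr_sumr; congr (_ + _).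
  by apply: eq_bigr => i _; rewrite -/(R (inl i)) R_inl /=; field; rewrite q0 l0.
rewrite -sumrN; apply: eq_bigr => i _; rewrite -/(R (inr i)) R_inr /=.
by field; rewrite q0 n0.
Qed.

Let sum_pieri1 : \sum_p pieri_up p * l p - \sum_p pieri_down p * (n p / q)
  = \sum_i l i - \sum_i n i / t.
Proof.
apply: (mulfI qt'); transitivity (\sum_i b i - \sum_i a i); last first.
  rewrite !big_sumType /= -!mulr_suml -mulr_sumr; field; rewrite q0 t0 //.
rewrite -(sum_residues a b_inj) big_sumType /= mulrBr !mulr_sumr; congr (_ + _).
  by apply: eq_bigr => i _; rewrite -/(R (inl i)) R_inl /=; field; rewrite q0.
rewrite -sumrN; apply: eq_bigr => i _; rewrite -/(R (inr i)) R_inr /=.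
by field; rewrite q0.
Qed.

Let sum_pieriV : \sum_p pieri_up p / l p - \sum_p pieri_down p / (n p / q)
  = \sum_i (l i)^-1 - \sum_i (n i / t)^-1.
Proof.
apply: (mulfI qt').
transitivity (t / q * (\sum_i (a i)^-1 - \sum_i (b i)^-1)); last first.
  rewrite !big_sumType /=.
  have -> : \sum_i (t / q * l i)^-1 = q / t * \sum_i (l i)^-1.
    by rewrite mulr_sumr; apply: eq_bigr => i _; field; rewrite q0 t0 l0.
  have -> : \sum_i (n i / t)^-1 = t * \sum_i (n i)^-1.
    by rewrite mulr_sumr; apply: eq_bigr => i _; field; rewrite t0 n0.
  have -> : \sum_i (n i / q)^-1 = q * \sum_i (n i)^-1.
    by rewrite mulr_sumr; apply: eq_bigr => i _; field; rewrite q0 n0.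
  by field; rewrite q0 t0.
rewrite -[X in _ = X * _]quot0 -(sum_residues_div2 b_inj b0 a0) big_sumType /= mulrBr !mulr_sumr.
congr (_ + _).
  by apply: eq_bigr => i _; rewrite -/(R (inl i)) R_inl /=; field; rewrite q0 l0.
rewrite -sumrN; apply: eq_bigr => i _; rewrite -/(R (inr i)) R_inr /=.
by field; rewrite q0 n0.
Qed.

(** Since [br z] is a combination of z and 1/z, the three residue sums with weights x, -c and -1/c
    add up to the claim. *)
Lemma pieri_sums (x c : K) (br := fun z => c * z + (c * z)^-1) :
  \sum_p pieri_up p * (x - br (l p)) - \sum_p pieri_down p * (x - br (n p / q))
  = x - \sum_i br (l i) + \sum_j br (n j / t).
Proof.
have split2 (I : finType) (F z : I -> K) : \sum_i F i * (x - br (z i)) =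
    (\sum_i F i) * x - c * (\sum_i F i * z i) - c^-1 * \sum_i F i / z i.
  rewrite mulr_suml !mulr_sumr -!sumrB; apply: eq_bigr => i _.
  by rewrite /br invfM; ring.
have split1 (I : finType) (z : I -> K) : \sum_i br (z i) =
    c * (\sum_i z i) + c^-1 * \sum_i (z i)^-1.
  by rewrite !mulr_sumr -big_split; apply: eq_bigr => i _; rewrite /br invfM.
rewrite !split1 !split2.
transitivity (x * (\sum_p pieri_up p - \sum_p pieri_down p)
  - c * (\sum_p pieri_up p * l p - \sum_p pieri_down p * (n p / q))
  - c^-1 * (\sum_p pieri_up p / l p - \sum_p pieri_down p / (n p / q))); first by ring.
by rewrite sum_pieri0 sum_pieri1 sum_pieriV; ring.
Qed.

End PieriSums.

(** * Products that change in few factors *)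

Section ProdUpdate.
Variable K : comNzRingType.

Lemma prod_update (F F' : nat -> K) a b j0 c : (a <= j0 < b)%N ->
  F' j0 = F j0 * c ->
  (forall j, (a <= j < b)%N -> j != j0 -> F' j = F j) ->
  \prod_(a <= j < b) F' j = (\prod_(a <= j < b) F j) * c.
Proof.
move=> /andP[aj jb] E E'.
rewrite !(big_cat_nat aj (ltnW jb)) /= !(big_ltn jb) E.
rewrite (@eq_big_nat _ 1 *%R a j0 F' F); last first.
  by move=> j /andP[j1 j2]; rewrite E' ?j1 ?(ltn_trans j2) ?neq_ltn ?j2.
rewrite (@eq_big_nat _ 1 *%R j0.+1 b F' F); last first.
  by move=> j /andP[j1 j2]; rewrite E' ?j2 ?(leq_trans aj) ?(ltnW j1) // neq_ltn j1 orbT.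
by rewrite !mulrA; ring.
Qed.

(** The pattern met when a square is added in row p: every earlier row and row p itself gain one
    factor, the later rows none. *)
Lemma prod_update_lt (F F' f : nat -> K) p n e : (p < n)%N ->
  (forall i, (i < p)%N -> F' i = F i * f i) -> F' p = F p * e ->
  (forall i, (p < i < n)%N -> F' i = F i) ->
  \prod_(0 <= i < n) F' i = (\prod_(0 <= i < n) F i) * e * \prod_(0 <= i < p) f i.
Proof.
move=> pn E1 E2 E3.
rewrite !(big_cat_nat (leq0n p) (ltnW pn)) /= !(big_ltn pn) E2.
rewrite (@eq_big_nat _ 1 *%R 0 p F' (fun i => F i * f i)); last first.
  by move=> j /andP[_ j2]; rewrite E1.
rewrite big_split /= (@eq_big_nat _ 1 *%R p.+1 n F' F) //.
by ring.
Qed.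

Lemma prod_ord_neq n (F : nat -> K) (p : 'I_n) :
  \prod_(i < n | i != p) F i = (\prod_(0 <= i < p) F i) * \prod_(p.+1 <= i < n) F i.
Proof.
have -> : \prod_(i < n | i != p) F i = \prod_(i < n) (if (i : nat) == p then 1 else F i).
  rewrite big_mkcond; apply: eq_bigr => i _; rewrite -val_eqE.
  by case: eqP.
rewrite -(big_mkord xpredT (fun i => if i == p then 1 else F i)).
rewrite (big_cat_nat (leq0n p) (ltnW (ltn_ord p))) /= (big_ltn (ltn_ord p)) eqxx mul1r.
by congr (_ * _); apply: eq_big_nat => i /andP[h1 h2]; rewrite ifF //; apply/eqP; lia.
Qed.
End ProdUpdate.

(** * The coefficients psi and the Pieri coefficients *)

Section Psi.
Variables (K : fieldType) (q t : K).
Hypothesis gen : forall a b c d, q ^+ a * t ^+ b = q ^+ c * t ^+ d -> a = c /\ b = d.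

Lemma generic_q_neq0 : q != 0.
Proof.
by apply/eqP => q0; have [] := @gen 1 0 2 0; rewrite ?q0 ?expr0n ?mul0r //.
Qed.
Lemma generic_t_neq0 : t != 0.
Proof.
by apply/eqP => t0; have [] := @gen 0 1 0 2; rewrite ?t0 ?expr0n ?mulr0 //.
Qed.

Let q0 := generic_q_neq0.
Let t0 := generic_t_neq0.

(* Rows are numbered from 0 from here on; the points q^{la_i} t^{-i} attached to
   the rows of la are [pnt (la i) i]. *)
Definition pnt (k i : nat) : K := q ^+ k / t ^+ i.

Lemma pnt_neq0 k i : pnt k i != 0.
Proof. by rewrite mulf_neq0 ?invr_neq0 ?expf_neq0. Qed.

Lemma pntSl k i : pnt k.+1 i = q * pnt k i.
Proof. by rewrite /pnt exprS mulrA. Qed.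

Lemma pntSr k i : pnt k i.+1 = pnt k i / t.
Proof. by rewrite /pnt exprSr invfM; ring. Qed.

Lemma pnt_inj k i m j : pnt k i = pnt m j -> k = m /\ i = j.
Proof.
move=> E; have [|-> ->//] := @gen k j m i.
apply/(mulIf (_ : (t ^+ i * t ^+ j)^-1 != 0)).
  by rewrite invr_neq0 ?mulf_neq0 ?expf_neq0.
transitivity (pnt k i); last rewrite E; rewrite /pnt; field; by rewrite !expf_neq0.
Qed.

Lemma pnt_sub_neq0 k i m j : (k != m) || (i != j) -> pnt k i - pnt m j != 0.
Proof.
by move=> h; rewrite subr_eq0; apply/eqP => /pnt_inj [e1 e2]; move: h; rewrite e1 e2 !eqxx.
Qed.

Lemma pnt_div_neq1 k i m j : (k != m) || (i != j) -> 1 - pnt k i / pnt m j != 0.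
Proof.
move=> h; rewrite -(divff (pnt_neq0 m j)) -mulrBl mulf_neq0 ?invr_neq0 ?pnt_neq0 //.
by rewrite pnt_sub_neq0 // eq_sym [j == i]eq_sym.
Qed.

(** With phi the infinite product defining psi, this is phi(z/u) / phi(qz/u). Hence
    [gprod a b i j m] is the value of phi at k = a divided by its value at k = b, the argument being
    q^{k-m} t^{j-i}. *)
Definition g1 (z u : K) := (1 - t * z / u) / (1 - q * z / u).

Definition gprod a b i j m := \prod_(a <= k < b) g1 (pnt k i) (pnt m j).

(* The effect on [gprod] of lengthening row j by one square, by telescoping. *)
Definition gratio a b i j m :=
  ((1 - pnt a i / pnt m.+1 j.+1) * (1 - pnt b i / pnt m j))
  / ((1 - pnt b i / pnt m.+1 j.+1) * (1 - pnt a i / pnt m j)).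

(** Raising k by 1 multiplies z = [pnt k i] by q, so the quotients of [g1] at m+1 by [g1] at m
    telescope. The condition on k keeps the cancelled factors nonzero. *)
Lemma gprodS a b i j m : (a <= b)%N ->
  (forall k, (a <= k <= b)%N -> ((k != m) || (i != j)) && ((k != m.+1) || (i != j.+1))) ->
  gprod a b i j m.+1 = gprod a b i j m * gratio a b i j m.
Proof.
elim: b => [|b IHb].
  case: a => // _ /(_ 0%N isT)/andP[h1 h2]; rewrite /gprod !big_geq // mul1r /gratio.
  by rewrite divff // mulf_neq0 // pnt_div_neq1.
rewrite leq_eqVlt => /orP[/eqP <- /(_ a)|ab hk].
  rewrite leqnn => /(_ isT)/andP[h1 h2]; rewrite /gprod !big_geq // mul1r /gratio.
  by rewrite divff // mulf_neq0 // pnt_div_neq1.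
have ab' : (a <= b)%N by [].
rewrite /gprod !big_nat_recr //= -/(gprod _ _ _ _ _) -/(gprod _ _ _ _ _) IHb //; last first.
  by move=> k /andP[h1 h2]; apply: hk; rewrite h1 ltnW.
have /andP[a1 a2] : ((a != m) || (i != j)) && ((a != m.+1) || (i != j.+1)).
  by apply: hk; rewrite leqnn ltnW.
have /andP[b1 b2] : ((b != m) || (i != j)) && ((b != m.+1) || (i != j.+1)).
  by apply: hk; rewrite ab' ltnW.
have /andP[c1 c2] : ((b.+1 != m) || (i != j)) && ((b.+1 != m.+1) || (i != j.+1)).
  by apply: hk; rewrite leqnn ltnW.
rewrite -[LHS]mulrA -[RHS]mulrA; congr (_ * _).
have := pnt_div_neq1 a1; have := pnt_div_neq1 a2.
have := pnt_div_neq1 b1; have := pnt_div_neq1 b2.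
have := pnt_div_neq1 c1; have := pnt_div_neq1 c2.
rewrite /gratio /g1.
have -> : pnt b.+1 i / pnt m.+1 j.+1 = t * pnt b i / pnt m j.
  by rewrite !pntSl !pntSr; field; rewrite q0 t0 pnt_neq0.
have -> : pnt b.+1 i / pnt m j = q * pnt b i / pnt m j by rewrite pntSl.
have -> : t * pnt b i / pnt m.+1 j = pnt b i / pnt m.+1 j.+1.
  by rewrite !pntSl !pntSr; field; rewrite q0 t0 pnt_neq0.
have -> : q * pnt b i / pnt m.+1 j = pnt b i / pnt m j.
  by rewrite !pntSl; field; rewrite q0 pnt_neq0.
set x1 := 1 - _; set x2 := 1 - _; set x3 := 1 - _.
set x4 := 1 - _; set x5 := 1 - _; set x6 := 1 - _.
move=> y1 y2 y3 y4 y5 y6.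
by field; rewrite ?y1 ?y2 ?y3 ?y4 ?y5 ?y6.
Qed.

(* psi_{la/nu} with the columns j < N in place of j < l(nu), which only adds
   factors 1 as long as nu has at most N rows. The column index k runs over the
   squares of row i of la/nu; 1/g1(z, t w) is (1 - qz/(tw)) / (1 - z/w). *)
Definition psig N (la nu : nat -> nat) :=
  \prod_(0 <= i < N.+1) \prod_(i <= j < N)
    (gprod (nu i) (la i) i j (nu j) / gprod (nu i) (la i) i j (la j.+1)).

(** This is the condition that la/nu is a horizontal strip; it also forces both sequences to
    decrease weakly. *)
Definition interlace (la nu : nat -> nat) := forall i, (la i.+1 <= nu i <= la i)%N.

Definition incr (la : nat -> nat) p := fun i => (la i + (i == p))%N.

(** The coefficient of P_{la + e_p} in (x_1 + ... + x_n) P_la, by the Pieri formula for ordinary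
    Macdonald polynomials. It vanishes, through the factor i = p-1, when rows p-1 and p are equal
    and no square can be added. *)
Definition pieri_coef (la : nat -> nat) p :=
  \prod_(0 <= i < p)
    (((1 - pnt (la i) i / (t * pnt (la p) p)) * (1 - t * pnt (la i) i / (q * pnt (la p) p)))
     / ((1 - pnt (la i) i / pnt (la p) p) * (1 - pnt (la i) i / (q * pnt (la p) p)))).

Lemma incr_eq la p : incr la p p = (la p).+1.
Proof. by rewrite /incr eqxx addn1. Qed.

Lemma incr_neq la p i : i != p -> incr la p i = la i.
Proof. by rewrite /incr => /negPf->; rewrite addn0. Qed.

Lemma tpnt k i : t * pnt k i.+1 = pnt k i.
Proof. by rewrite pntSr; field; rewrite t0. Qed.

Lemma gprod_neq0 a b i j m : (i <= j)%N ->
  (forall k, (a <= k < b)%N -> (k.+1 != m) || (i != j)) -> gprod a b i j m != 0.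
Proof.
move=> ij h; rewrite /gprod prodf_seq_neq0; apply/allP => k /=.
rewrite mem_index_iota => /h hk; rewrite /g1 mulf_neq0 ?invr_neq0 //.
  rewrite -[pnt m j]tpnt invfM mulrACA divff // mul1r.
  by rewrite pnt_div_neq1 //; apply/orP; right; apply/eqP; lia.
by rewrite -pntSl pnt_div_neq1.
Qed.

Lemma gratio_neq0 a b i j m :
  (forall k, k \in [:: a; b] -> ((k != m) || (i != j)) && ((k != m.+1) || (i != j.+1))) ->
  gratio a b i j m != 0.
Proof.
move=> h; have /andP[a1 a2] := h a (mem_head _ _).
have /andP[b1 b2] : ((b != m) || (i != j)) && ((b != m.+1) || (i != j.+1)).
  by apply: h; rewrite !inE eqxx orbT.
by rewrite /gratio !mulf_neq0 ?invr_neq0 ?mulf_neq0 ?pnt_div_neq1.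
Qed.

Section Up.
Variables (N : nat) (la nu : nat -> nat) (p : 'I_N.+1).
Hypotheses (Ila : interlace la nu) (Ila' : interlace (incr la p) nu).

(** The length of row p enters row p of the product as the upper limit of k, and the rows i < p as
    [la j.+1] with j = p-1. *)
Lemma psig_incr : psig N (incr la p) nu = psig N la nu
  * \prod_(p <= j < N) (g1 (pnt (la p) p) (pnt (nu j) j) / g1 (pnt (la p) p) (pnt (la j.+1) j))
  * \prod_(0 <= i < p) (gratio (nu i) (la i) i p.-1 (la p))^-1.
Proof.
rewrite /psig; apply: prod_update_lt => // [i ip||i /andP[pi iN]].
- have /prednK p_pos : (0 < p)%N by apply: leq_ltn_trans ip.
  apply: (prod_update (j0 := p.-1)).
  + by have := ltn_ord p; rewrite -p_pos ltnS => ->; rewrite -ltnS p_pos ip.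
  + rewrite p_pos incr_eq (incr_neq _ (i := i)) ?neq_ltn ?ip //.
    rewrite gprodS.
    * by rewrite invfM mulrA.
    * by case/andP: (Ila i).
    move=> k /andP[k1 k2]; apply/andP; split; last by apply/orP; right; apply/eqP; lia.
    case: (ltngtP i p.-1) => [|?|E]; rewrite ?orbT // /=.
    rewrite orbF; apply/eqP => E2; have := Ila' i; rewrite E in k1 *;
      rewrite p_pos incr_eq; lia.
  + move=> j /andP[j1 j2] jp; rewrite (@incr_neq _ _ i) ?(@incr_neq _ _ j.+1) //.
      by apply/eqP; move/eqP: jp; lia.
    by rewrite neq_ltn ip.
- rewrite -big_split; apply: eq_big_nat => j /andP[pj jN] /=.
  rewrite incr_eq (incr_neq _ (i := j.+1)) ?neq_ltn ?ltnS ?pj ?orbT //.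
  rewrite /gprod !big_nat_recr //=; try by case/andP: (Ila p).
  by rewrite invfM; ring.
- apply: eq_big_nat => j /andP[ij jN].
  rewrite !incr_neq // neq_ltn ?pi ?orbT //.
  by rewrite ltnS (ltnW (leq_trans pi ij)) orbT.
Qed.

(** Adding a square to la multiplies psi by the residue at l_p, up to the Pieri coefficient. *)
Lemma psig_up : pieri_coef la p * psig N (incr la p) nu
  = pieri_up q t (fun i : 'I_N.+1 => pnt (la i) i) (fun j : 'I_N => pnt (nu j) j) p
    * psig N la nu.
Proof.
rewrite psig_incr; set e := \prod_(p <= j < N) _; set f := \prod_(0 <= i < p) _.
suff E : pieri_coef la p * (e * f)
  = pieri_up q t (fun i : 'I_N.+1 => pnt (la i) i) (fun j : 'I_N => pnt (nu j) j) p.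
  by rewrite -E; ring.
have pN : (p <= N)%N by rewrite -ltnS.
rewrite /pieri_up /=.
rewrite (prod_ord_neq (fun i => (pnt (la p) p - t / q * pnt (la i) i) / (pnt (la p) p - pnt (la i) i)) p).
rewrite -(big_mkord xpredT (fun j => (pnt (la p) p - pnt (nu j) j / t) / (pnt (la p) p - pnt (nu j) j / q))).
(* Below p the factors of l_i and n_i are paired; beyond p those of l_{j+1} and n_j. *)
rewrite (big_cat_nat (leq0n p) pN) big_add1 /=.
rewrite [RHS]mulrACA [e * f]mulrC [LHS]mulrA /e /f /pieri_coef -!big_split /=.
congr (_ * _).
  apply: eq_big_nat => i /andP[_ ip].
  set P := pnt (la p) p; set n := pnt (nu i) i; set L := pnt (la i) i.
  have /prednK p_pos : (0 < p)%N by apply: leq_ltn_trans ip.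
  rewrite /gratio p_pos pntSl -/P -/L -/n.
  have tP : pnt (la p) p.-1 = t * P by rewrite /P -[in RHS]p_pos tpnt p_pos.
  rewrite tP.
  have pi b : b || ((p : nat) != i) by rewrite (gtn_eqF ip) orbT.
  have P0 : P != 0 by rewrite pnt_neq0.
  have PL : P - L != 0 by rewrite pnt_sub_neq0.
  have qPL : q * P - L != 0 by rewrite -pntSl pnt_sub_neq0.
  have qPn : q * P - n != 0 by rewrite -pntSl pnt_sub_neq0.
  (* A zero here would need i = p-1 and la_p equal to la_{p-1} or nu_{p-1}, which the strip (la +
     e_p)/nu excludes. *)
  have [tPL tPn] : t * P - L != 0 /\ t * P - n != 0.
    rewrite -tP !pnt_sub_neq0 //.
      case: (ltngtP i p.-1) => [?|?|E]; rewrite ?orbT //= orbF; apply/eqP => E2.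
      by have := Ila' p.-1; have := Ila p.-1; rewrite p_pos incr_eq -E; lia.
    case: (ltngtP i p.-1) => [?|?|E]; rewrite ?orbT //= orbF; apply/eqP => E2.
    by have := Ila' p.-1; have := Ila p.-1; rewrite p_pos incr_eq -E; lia.
  by field; rewrite ?q0 ?t0 ?P0 ?PL ?qPL ?tPL ?tPn /= mulrC qPn.
apply: eq_big_nat => j /andP[pj jN].
set P := pnt (la p) p; set n := pnt (nu j) j; set L := pnt (la j.+1) j.+1.
rewrite /g1 -[pnt (la j.+1) j]tpnt -/L.
have P0 : P != 0 by rewrite pnt_neq0.
have n0 : n != 0 by rewrite pnt_neq0.
have L0 : L != 0 by rewrite pnt_neq0.
have PL : P - L != 0 by rewrite pnt_sub_neq0 // orbC; apply/orP; left; apply/eqP; lia.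
have Pn : q * P - n != 0.
  rewrite -pntSl pnt_sub_neq0 //; case: (ltngtP p j) pj => // [|E _];
    rewrite ?orbT ?orbF //.
  by rewrite -E; apply/eqP; have := Ila p; lia.
have tL : t * L - q * P != 0.
  rewrite tpnt -pntSl pnt_sub_neq0 //; case: (ltngtP j p) pj => // [|E _];
    rewrite ?orbT ?orbF //.
  by rewrite E; apply/eqP; have := Ila p; lia.
have LP : L - P != 0 by rewrite -opprB oppr_eq0.
have nP : n - q * P != 0 by rewrite -opprB oppr_eq0.
by field; rewrite ?q0 ?t0 ?P0 ?n0 ?L0 ?Pn ?tL ?LP ?nP ?PL [P * q]mulrC Pn.
Qed.

End Up.

Section Down.
Variables (N : nat) (la ka : nat -> nat) (p : 'I_N).
Hypotheses (Ila : interlace la ka) (Ila' : interlace la (incr ka p)).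
Let nu := incr ka p.
Let P := pnt (ka p) p.

(** The length of row p of nu enters the rows i <= p through j = p, and row p also as the lower
    limit of k. *)
Lemma psig_decr : psig N la ka = psig N la nu
  * ((\prod_(p <= j < N) (g1 P (pnt (ka j) j) / g1 P (pnt (la j.+1) j)))
     / gratio (ka p).+1 (la p) p p (ka p))
  * \prod_(0 <= i < p) (gratio (ka i) (la i) i p (ka p))^-1.
Proof.
have lap : (ka p < la p)%N by have := Ila' p; rewrite incr_eq; lia.
rewrite /psig; apply: prod_update_lt => [|i ip||i /andP[pi iN]].
- by rewrite ltnS ltnW.
- have E : \prod_(i <= j < N) (gprod (nu i) (la i) i j (nu j) / gprod (nu i) (la i) i j (la j.+1))
    = \prod_(i <= j < N) (gprod (ka i) (la i) i j (ka j) / gprod (ka i) (la i) i j (la j.+1))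
      * gratio (ka i) (la i) i p (ka p).
    apply: (prod_update (j0 := p)); first by rewrite (ltnW ip) ltn_ord.
      rewrite /nu incr_eq (@incr_neq _ _ i) ?neq_ltn ?ip // gprodS; first by rewrite mulrAC.
        by case/andP: (Ila i).
      by move=> k _; rewrite [i != p]neq_ltn [i != p.+1]neq_ltn ltnS ip (ltnW ip) !orbT.
    move=> j jN jp; rewrite /nu (@incr_neq _ _ i) ?neq_ltn ?ip // incr_neq //.
  rewrite E mulfK // gratio_neq0 // => k _.
  by rewrite [i != p]neq_ltn [i != p.+1]neq_ltn ltnS ip (ltnW ip) !orbT.
- have E : \prod_(p <= j < N) (gprod (nu p) (la p) p j (nu j) / gprod (nu p) (la p) p j (la j.+1))
    = \prod_(p <= j < N) (gprod (ka p).+1 (la p) p j (ka j) / gprod (ka p).+1 (la p) p j (la j.+1))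
      * gratio (ka p).+1 (la p) p p (ka p).
    apply: (prod_update (j0 := p)); first by rewrite leqnn ltn_ord.
      rewrite /nu incr_eq gprodS //; first by rewrite mulrAC.
      move=> k /andP[k1 _]; rewrite eqxx orbF (gtn_eqF k1) /=.
      by rewrite [p != p.+1 :> nat]neq_ltn ltnSn orbT.
    by move=> j jN jp; rewrite /nu incr_eq incr_neq.
  rewrite E mulrA mulrAC mulfK; last first.
    apply: gratio_neq0 => k; rewrite !inE => hk.
    have k1 : (ka p < k)%N by case/orP: hk => /eqP ->.
    by rewrite (gtn_eqF k1) [p != p.+1 :> nat]neq_ltn ltnSn orbT.
  rewrite -big_split; apply: eq_big_nat => j /andP[pj jN] /=.
  rewrite /gprod [\prod_(ka p <= _ < _) _]big_ltn // [X in _ / X = _]big_ltn //.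
  by rewrite invfM -/P; ring.
- apply: eq_big_nat => j /andP[ij jN].
  by rewrite /nu !incr_neq // neq_ltn ?pi ?orbT // (leq_trans pi ij) orbT.
Qed.

Lemma psig_down : pieri_coef ka p * psig N la ka
  = pieri_down q t (fun i : 'I_N.+1 => pnt (la i) i) (fun j : 'I_N => pnt (nu j) j) p
    * psig N la nu.
Proof.
rewrite psig_decr; set e := _ / gratio _ _ _ _ _; set f := \prod_(0 <= i < p) _.
suff E : pieri_coef ka p * (e * f)
  = pieri_down q t (fun i : 'I_N.+1 => pnt (la i) i) (fun j : 'I_N => pnt (nu j) j) p.
  by rewrite -E; ring.
have lap : (ka p < la p)%N by have := Ila' p; rewrite incr_eq; lia.
have lap1 : (la p.+1 <= ka p)%N by case/andP: (Ila p).
have pN := ltn_ord p.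
have nuP : pnt (nu p) p / q = P by rewrite /nu incr_eq pntSl mulrC mulKf.
rewrite /pieri_down /= nuP.
rewrite (prod_ord_neq (fun j => (P - pnt (nu j) j / t) / (P - pnt (nu j) j / q)) p).
rewrite -(big_mkord xpredT (fun i => (P - t / q * pnt (la i) i) / (P - pnt (la i) i))).
rewrite (big_cat_nat (leq0n p) (leqW (ltnW pN))) /= (@big_ltn _ _ _ p) ?ltnS 1?ltnW //.
rewrite big_add1 /= (@big_ltn _ _ _ p) //= /e (@big_ltn _ _ _ p) //=.
set A0 := \prod_(0 <= i < p) _; set A1 := (P - _) / _; set A2 := (P - _) / _.
set C1 := \prod_(p.+1 <= i < N) _; set B0 := \prod_(0 <= i < p) _.
set A3 := \prod_(p.+1 <= i < N) _; set C0 := g1 P _ / _; set B1 := \prod_(p.+1 <= i < N) _.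
(* Three groups of factors: indices below p, indices beyond p with l_{j+1} paired to n_j, and the
   leftover l_p and l_{p+1}, which absorb the scalar q/t. *)
suff [E1 E2 E3] : [/\ pieri_coef ka p * f = A0 * B0, C1 = A3 * B1 &
    C0 / gratio (ka p).+1 (la p) p p (ka p) = q / t * (A1 * A2)].
  transitivity ((pieri_coef ka p * f) * (C0 / gratio (ka p).+1 (la p) p p (ka p)) * C1).
    by ring.
  by rewrite E1 E2 E3; ring.
have P0 : P != 0 by rewrite pnt_neq0.
split.
- rewrite /pieri_coef -!big_split; apply: eq_big_nat => i /andP[_ ip] /=.
  rewrite /nu (@incr_neq _ _ i) ?neq_ltn ?ip // /gratio pntSl pntSr -/P.
  set n := pnt (ka i) i; set L := pnt (la i) i.
  have pi b : b || ((p : nat) != i) by rewrite (gtn_eqF ip) orbT.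
  have PL : P - L != 0 by rewrite pnt_sub_neq0.
  have Pn : P - n != 0 by rewrite pnt_sub_neq0.
  have qPn : q * P - n != 0 by rewrite -pntSl pnt_sub_neq0.
  have qPtL : q * P - t * L != 0.
    have -> : q * P - t * L = t * (pnt (ka p).+1 p.+1 - L) by rewrite mulrBr tpnt pntSl.
    by rewrite mulf_neq0 // pnt_sub_neq0 // orbC (gtn_eqF (leqW ip)).
  have qPtn : q * P - t * n != 0.
    have -> : q * P - t * n = t * (pnt (ka p).+1 p.+1 - n) by rewrite mulrBr tpnt pntSl.
    by rewrite mulf_neq0 // pnt_sub_neq0 // orbC (gtn_eqF (leqW ip)).
  by field; rewrite ?q0 ?t0 ?P0 ?PL ?Pn [P * q]mulrC ?qPn [L * t]mulrC [n * t]mulrC qPtL.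
- rewrite -big_split; apply: eq_big_nat => j /andP[pj jN] /=.
  rewrite /nu incr_neq ?neq_ltn ?pj ?orbT // /g1 -[pnt (la j.+1) j]tpnt.
  set n := pnt (ka j) j; set L := pnt (la j.+1) j.+1.
  have n0 : n != 0 by rewrite pnt_neq0.
  have L0 : L != 0 by rewrite pnt_neq0.
  have jp b : b || (j != p) by rewrite (gtn_eqF pj) orbT.
  have j1p b : b || (j.+1 != p) by rewrite gtn_eqF ?orbT // leqW.
  have LP : L - P != 0 by rewrite pnt_sub_neq0.
  have PL : P - L != 0 by rewrite -opprB oppr_eq0.
  have nP : n - q * P != 0 by rewrite -pntSl pnt_sub_neq0.
  have Pn : q * P - n != 0 by rewrite -opprB oppr_eq0.
  have tL : t * L - q * P != 0 by rewrite tpnt -pntSl pnt_sub_neq0.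
  by field; rewrite ?q0 ?t0 ?P0 ?L0 ?PL ?LP ?tL ?n0 ?nP [P * q]mulrC Pn.
rewrite /C0 /A1 /A2 /gratio /g1 -[pnt (la p.+1) p]tpnt.
set L1 := pnt (la p.+1) p.+1; set L := pnt (la p) p.
rewrite [pnt (ka p).+1 p.+1]pntSr !pntSl -/P.
have q1 : 1 - q != 0.
  by have := @pnt_sub_neq0 0 0 1 0 isT; rewrite /pnt !expr0 expr1 !divr1.
have t1 : 1 - t != 0.
  have -> : 1 - t = t * (pnt 0 1 - pnt 0 0) by rewrite mulrBr tpnt /pnt !expr0 divr1 mulr1.
  by rewrite mulf_neq0 // pnt_sub_neq0.
have L0 : L1 != 0 by rewrite pnt_neq0.
have PL : P - L != 0 by rewrite pnt_sub_neq0 // ltn_eqF.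
have LP : L1 - P != 0 by rewrite pnt_sub_neq0 // orbC gtn_eqF.
have PL1 : P - L1 != 0 by rewrite -opprB oppr_eq0.
have tL1 : t * L1 - q * P != 0 by rewrite tpnt -pntSl pnt_sub_neq0 // ltn_eqF.
have qPL : q * P - t * L != 0.
  have -> : q * P - t * L = t * (pnt (ka p).+1 p.+1 - L) by rewrite mulrBr tpnt pntSl.
  by rewrite mulf_neq0 // pnt_sub_neq0 // orbC gtn_eqF.
by field; rewrite ?q0 ?t0 ?P0 ?L0 ?PL ?LP ?PL1 ?tL1 ?q1 ?t1 [L * t]mulrC qPL.
Qed.

End Down.

(** Here la and nu = ka + e_p do not interlace, yet adding a square to la or removing one from nu
    repairs this; the two contributions agree. Row p of each strip is empty, and a row i < p changes
    through [nu p] at j = p and [la p] at j = p-1. *)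
Lemma psig_boundary N (la ka : nat -> nat) (p : 'I_N) :
  interlace la ka -> interlace (incr la p) (incr ka p) -> la p = ka p ->
  pieri_coef la p * psig N (incr la p) (incr ka p) = psig N la ka * pieri_coef ka p.
Proof.
move=> Ila Ila' lk.
have -> : psig N (incr la p) (incr ka p) = psig N la ka * 1 *
   \prod_(0 <= i < p) (gratio (ka i) (la i) i p (ka p) / gratio (ka i) (la i) i p.-1 (la p)).
  rewrite /psig; apply: prod_update_lt => [|i ip||i /andP[pi iN]].
  - by rewrite ltnS ltnW.
  - have /prednK p_pos : (0 < p)%N by apply: leq_ltn_trans ip.
    have [ip1 p1N] : (i <= p.-1)%N /\ (p.-1 < N)%N.
      by have := ltn_ord p; split; lia.
    rewrite mulrA.
    transitivity (\prod_(i <= j < N) (gprod (ka i) (la i) i j (incr ka p j)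
        / gprod (ka i) (la i) i j (la j.+1)) / gratio (ka i) (la i) i p.-1 (la p)).
      apply: (prod_update (j0 := p.-1)); first by rewrite ip1.
        rewrite p_pos incr_eq (@incr_neq la _ i) ?(@incr_neq ka _ i) ?neq_ltn ?ip //.
        rewrite gprodS.
        + by rewrite invfM mulrA.
        + by case/andP: (Ila i).
        move=> k /andP[k1 k2]; apply/andP; split; last by apply/orP; right; apply/eqP; lia.
        case: (ltngtP i p.-1) => [|?|E]; rewrite ?orbT // /=.
        rewrite orbF; apply/eqP => E2; have := Ila' p.-1.
        by rewrite p_pos -E incr_eq (@incr_neq ka) ?neq_ltn ?ip //; lia.
      move=> j /andP[j1 j2] jp.
      rewrite (@incr_neq la _ i) ?(@incr_neq ka _ i) ?(@incr_neq _ _ j.+1) ?neq_ltn ?ip //.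
      by rewrite -neq_ltn; apply/eqP; move/eqP: jp; lia.
    congr (_ / _); apply: (prod_update (j0 := p)); first by rewrite (ltnW ip) ltn_ord.
      rewrite incr_eq gprodS; first by rewrite mulrAC.
        by case/andP: (Ila i).
      by move=> k _; rewrite [i != p]neq_ltn [i != p.+1]neq_ltn ltnS ip (ltnW ip) !orbT.
    by move=> j jN jp; rewrite incr_neq.
  - rewrite mulr1; apply: eq_big_nat => j _.
    by rewrite !incr_eq lk /gprod !big_geq.
  - apply: eq_big_nat => j /andP[ij jN].
    have ip : i != p by rewrite gtn_eqF.
    have jp : j != p by rewrite gtn_eqF // (leq_trans pi).
    have j1p : j.+1 != p by rewrite gtn_eqF // ltnS ltnW // (leq_trans pi).
    by rewrite !incr_neq.
rewrite mulr1 mulrCA; congr (_ * _).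
rewrite /pieri_coef -big_split; apply: eq_big_nat => i /andP[_ ip] /=.
have /prednK p_pos : (0 < p)%N by apply: leq_ltn_trans ip.
rewrite lk /gratio p_pos !pntSl.
have -> : pnt (ka p) p.-1 = t * pnt (ka p) p by rewrite -{4}p_pos tpnt.
rewrite [pnt _ p.+1]pntSr.
set P := pnt (ka p) p; set n := pnt (ka i) i; set L := pnt (la i) i.
have P0 : P != 0 by rewrite pnt_neq0.
have pi b : b || ((p : nat) != i) by rewrite (gtn_eqF ip) orbT.
have hi := Ila' p.-1; rewrite p_pos incr_eq in hi.
have h1 : (i == p.-1) -> (ka p < ka i)%N.
  move/eqP=> E; move: hi; rewrite -E (@incr_neq ka) ?neq_ltn ?ip //; lia.
have h2 : (i == p.-1) -> (ka p < la i)%N.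
  by move=> E; apply: (leq_trans (h1 E)); case/andP: (Ila i).
have [tPn tPL] : t * P - n != 0 /\ t * P - L != 0.
  have -> : t * P = pnt (ka p) p.-1 by rewrite /P -{2}p_pos tpnt.
  rewrite !pnt_sub_neq0 //; case: (eqVneq p.-1 i) => [E|_]; rewrite ?orbT //= orbF.
    by rewrite ltn_eqF // h2 // E.
  by rewrite ltn_eqF // h1 // E.
have PL : P - L != 0 by rewrite pnt_sub_neq0.
have Pn : P - n != 0 by rewrite pnt_sub_neq0.
have qPL : q * P - L != 0 by rewrite -pntSl pnt_sub_neq0.
have qPn : q * P - n != 0 by rewrite -pntSl pnt_sub_neq0.
have qPtL : q * P - t * L != 0.
  have -> : q * P - t * L = t * (pnt (ka p).+1 p.+1 - L) by rewrite mulrBr tpnt pntSl.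
  by rewrite mulf_neq0 // pnt_sub_neq0 // orbC (gtn_eqF (leqW ip)).
by field; rewrite ?q0 ?t0 ?P0 ?PL ?Pn ?qPL ?qPn ?tPL ?tPn [L * t]mulrC qPtL.
Qed.

End Psi.

(** * Transfer operators *)

Section Transfer.
Variables (K : fieldType) (q t : K).
Hypothesis gen : forall a b c d, q ^+ a * t ^+ b = q ^+ c * t ^+ d -> a = c /\ b = d.
Let q0 : q != 0 := generic_q_neq0 gen.
Let t0 : t != 0 := generic_t_neq0 gen.
Local Notation pnt := (pnt q t).

(* [gbracket s k i] is [i+1, k] in the notation of the paper. *)
Definition gbracket (s : K) (k i : nat) : K :=
  s * q ^+ k.+1 / t ^+ i.+2 + (s * q ^+ k.+1 / t ^+ i.+2)^-1.

(** The bracket in the form [br] of [pieri_sums], with c = s q / t^2. *)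
Lemma gbracketE s k i : gbracket s k i = s * q / t ^+ 2 * pnt k i + (s * q / t ^+ 2 * pnt k i)^-1.
Proof.
rewrite /gbracket; suff -> : s * q ^+ k.+1 / t ^+ i.+2 = s * q / t ^+ 2 * pnt k i by [].
by rewrite /pnt exprS !exprSr expr0 mul1r !invfM; ring.
Qed.

(** Dropping a first row amounts to replacing s by s/t; hence successive transfer operators carry s,
    s/t, s/t^2, and so on. *)
Lemma gbracket_shift s k i : gbracket s k i.+1 = gbracket (s / t) k i.
Proof.
rewrite /gbracket;
  suff -> : s * q ^+ k.+1 / t ^+ i.+3 = s / t * q ^+ k.+1 / t ^+ i.+2 by [].
by rewrite ![t ^+ _.+1]exprSr !invfM; ring.
Qed.

Definition Xstrip N (s x : K) (la nu : nat -> nat) : K :=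
  \prod_(0 <= i < N.+1) \prod_(nu i <= k < la i) (x - gbracket s k i).

Lemma Xstrip_incr N s x la nu p : (p < N.+1)%N -> (nu p <= la p)%N ->
  Xstrip N s x (incr la p) nu = Xstrip N s x la nu * (x - gbracket s (la p) p).
Proof.
move=> pN h; apply: (prod_update (j0 := p)) => //.
  by rewrite incr_eq big_nat_recr.
by move=> i _ ip; rewrite incr_neq.
Qed.

Lemma Xstrip_decr N s x la ka p : (p < N.+1)%N -> (ka p < la p)%N ->
  Xstrip N s x la ka = Xstrip N s x la (incr ka p) * (x - gbracket s (ka p) p).
Proof.
move=> pN h; apply: (prod_update (j0 := p)) => //.
  by rewrite incr_eq [LHS]big_ltn // mulrC.
by move=> i _ ip; rewrite incr_neq.
Qed.

Lemma Xstrip_boundary N s x la ka p : la p = ka p ->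
  Xstrip N s x (incr la p) (incr ka p) = Xstrip N s x la ka.
Proof.
move=> E; apply: eq_bigr => i _; case: (eqVneq i p) => [->|ip].
  by rewrite !incr_eq E !big_geq.
by rewrite !incr_neq.
Qed.

(** The square fails to fit only if nu_{p-1} = la_p, and then l_p = n_{p-1}/t is a zero of f. *)
Lemma pieri_up_eq0 N (la nu : nat -> nat) (p : 'I_N.+1) :
  interlace la nu -> ~ interlace (incr la p) nu ->
  pieri_up q t (fun i : 'I_N.+1 => pnt (la i) i) (fun j : 'I_N => pnt (nu j) j) p = 0.
Proof.
move=> I1 I2.
have [p0 E] : (0 < p)%N /\ nu p.-1 = la p.
  case: p I2 => -[|p] pN I2 /=.
    case: I2 => -[|i]; rewrite /incr ?addn0 //=; have := I1 0%N; lia.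
  split=> //; apply/eqP; apply/negPn/negP => /eqP ne; apply: I2 => i.
  have := I1 i; have := I1 p; rewrite /incr /=.
  case: (eqVneq i p) => [->|ip]; first by rewrite eqxx ltn_eqF //; lia.
  by rewrite (_ : (i.+1 == p.+1) = false) ?addn0; [lia|apply/eqP; move/eqP: ip; lia].
have p1N : (p.-1 < N)%N by have := ltn_ord p; lia.
apply/eqP; rewrite mulf_eq0; apply/orP; right; apply/eqP.
have -> : pnt (la p) p = pnt (la p) p.-1 / t by rewrite -pntSr prednK.
by rewrite (bigD1 (Ordinal p1N)) //= E subrr !mul0r.
Qed.

(** When row p of nu cannot be shortened, n_p/q = (t/q) l_{p+1} is a zero of f. *)
Lemma pieri_down_eq0 N (la nu : nat -> nat) (p : 'I_N) :
  la p.+1 = nu p ->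
  pieri_down q t (fun i : 'I_N.+1 => pnt (la i) i) (fun j : 'I_N => pnt (nu j) j) p = 0.
Proof.
move=> E; rewrite /pieri_down (bigD1 (lift ord0 p)) //= /bump leq0n add1n E pntSr.
have -> : pnt (nu p) p / q - t / q * (pnt (nu p) p / t) = 0 by field; rewrite q0 t0.
by rewrite !(mul0r, mulr0).
Qed.

Lemma pieri_sums_pnt N (la nu : nat -> nat) (s x : K) :
  interlace la nu ->
  \sum_(p < N.+1)
     pieri_up q t (fun i : 'I_N.+1 => pnt (la i) i) (fun j : 'I_N => pnt (nu j) j) p
     * (x - gbracket s (la p) p)
  - \sum_(p < N)
     pieri_down q t (fun i : 'I_N.+1 => pnt (la i) i) (fun j : 'I_N => pnt (nu j) j) p
     * (x - gbracket s (nu p).-1 p)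
  = x - \sum_(i < N.+1) gbracket s (la i) i + \sum_(i < N) gbracket (s / t) (nu i) i.
Proof.
move=> I1.
pose l := fun i : 'I_N.+1 => pnt (la i) i; pose n := fun j : 'I_N => pnt (nu j) j.
have qt : q != t.
  by apply/eqP => E; have [] := @gen 1 0 0 1; rewrite ?E // !expr0 mulr1 mul1r.
have l0 i : l i != 0 by rewrite pnt_neq0.
have n0 i : n i != 0 by rewrite pnt_neq0.
have l_inj : injective l by move=> i j /(pnt_inj gen) [_ /val_inj].
have n_inj : injective n by move=> i j /(pnt_inj gen) [_ /val_inj].
have ln i j : l i != n j / q.
  apply/eqP => /(congr1 ( *%R q)); rewrite [q * (_ / q)]mulrC divfK // -pntSl.
  by move/(pnt_inj gen) => [E1 E2]; have := I1 j; rewrite -E1 -E2 ltnn andbF.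
have := pieri_sums q0 t0 qt l0 n0 l_inj n_inj ln x (s * q / t ^+ 2).
rewrite /= -/l -/n => E.
under eq_bigr => p _ do rewrite gbracketE -/(l p).
under [\sum_(i < N.+1) gbracket s (la i) i]eq_bigr => p _ do rewrite gbracketE -/(l p).
under [\sum_(i < N) gbracket (s / t) _ _]eq_bigr => p _ do rewrite -gbracket_shift gbracketE pntSr -/(n p).
rewrite -E; congr (_ - _); apply: eq_bigr => p _.
(* For an empty row the predecessor is the default 0, but the coefficient vanishes because la_{p+1}
   = nu_p = 0. *)
case: (posnP (nu p)) => [nu0|nu_pos].
  by rewrite pieri_down_eq0 ?mul0r //; have := I1 p; lia.
by rewrite gbracketE /n -[nu p in RHS](prednK nu_pos) pntSl [q * _]mulrC mulfK.
Qed.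

End Transfer.

(** * Row lengths of diagrams *)

Definition rowlen n (m : 'X_{1..n}) : nat -> nat := fun i => nth 0%N m i.

Lemma row_ord n (m : 'X_{1..n}) (i : 'I_n) : rowlen m i = m i.
Proof. by rewrite /rowlen -mnm_nth. Qed.

Lemma row_over n (m : 'X_{1..n}) i : (n <= i)%N -> rowlen m i = 0%N.
Proof. by move=> ni; rewrite /rowlen nth_default // size_tuple. Qed.

Lemma row_inj n (m1 m2 : 'X_{1..n}) : rowlen m1 =1 rowlen m2 -> m1 = m2.
Proof. by move=> E; apply/mnmP => i; rewrite -!row_ord. Qed.

Lemma row_multinom n (F : nat -> nat) i :
  rowlen [multinom F i | i < n] i = if (i < n)%N then F i else 0%N.
Proof.
case: ltnP => [ilt|]; last by apply: row_over.
by rewrite -[i]/(val (Ordinal ilt)) row_ord mnmE.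
Qed.

Lemma row_addU n (m : 'X_{1..n}) (p : 'I_n) : rowlen (m + U_(p))%MM =1 incr (rowlen m) p.
Proof.
move=> i; case: (ltnP i n) => ni; last first.
  by rewrite !row_over // incr_neq ?row_over // gtn_eqF // (leq_trans _ ni).
rewrite -[i]/(val (Ordinal ni)) /incr !row_ord mnmDE mnm1E eq_sym.
by rewrite -val_eqE.
Qed.

Lemma row_subU n (m : 'X_{1..n}) (p : 'I_n) : (0 < m p)%N ->
  rowlen m =1 incr (rowlen (m - U_(p))%MM) p.
Proof.
move=> mp i; rewrite -row_addU; congr rowlen; apply/mnmP => j.
rewrite mnmDE mnmBE mnm1E subnK //.
by case: eqP => [<-|].
Qed.

Lemma subUK n (m : 'X_{1..n}) (p : 'I_n) : (0 < m p)%N -> (m - U_(p) + U_(p))%MM = m.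
Proof. by move=> mp; apply: row_inj => i; rewrite row_addU -row_subU. Qed.

(** A finite summation range that does not depend on the diagram, so that sums can be exchanged and
    reindexed. *)
Definition mnm_below n b : seq 'X_{1..n} := [seq bmnm m | m <- enum {: 'X_{1..n < b}}].

Lemma mem_mnm_below n b (m : 'X_{1..n}) : (m \in mnm_below n b) = (mdeg m < b)%N.
Proof.
apply/mapP/idP => [[k _ ->]|h]; first exact: bmdeg.
by exists (BMultinom h); rewrite ?mem_enum.
Qed.

Lemma mnm_below_uniq n b : uniq (mnm_below n b).
Proof. by rewrite map_inj_uniq ?enum_uniq //; apply: val_inj. Qed.

(** * Horizontal strips of a given diagram *)

Section Interlacing.
Variable N : nat.
Implicit Types la nu m : 'X_{1..N.+1}.

Definition interl la nu := [forall i : 'I_N.+1, (rowlen la i.+1 <= nu i <= la i)%N].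

Lemma interlP la nu : reflect (interlace (rowlen la) (rowlen nu)) (interl la nu).
Proof.
apply: (iffP forallP) => h i; last by have := h i; rewrite !row_ord.
case: (ltnP i N.+1) => ni; last by rewrite !row_over // ltnW.
by have := h (Ordinal ni); rewrite -!row_ord.
Qed.

Lemma interl_mdeg la nu : interl la nu -> (mdeg nu <= mdeg la)%N.
Proof.
move/forallP => h; rewrite !mdegE; apply: leq_sum => i _.
by case/andP: (h i).
Qed.

Definition strips la := [seq nu <- mnm_below N.+1 (mdeg la).+1 | interl la nu].

Lemma mem_strips la nu : (nu \in strips la) = interl la nu.
Proof.
rewrite mem_filter mem_mnm_below ltnS; case: (boolP (interl la nu)) => //= /interl_mdeg.
by move->.
Qed.

Lemma strips_uniq la : uniq (strips la).
Proof. by rewrite filter_uniq // mnm_below_uniq. Qed.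

End Interlacing.

(** * Matrix entries of the transfer and Pieri operators *)

Section Operators.
Variables (K : fieldType) (q t : K).
Hypothesis gen : forall a b c d, q ^+ a * t ^+ b = q ^+ c * t ^+ d -> a = c /\ b = d.
Local Notation gbracket := (gbracket q t).
Local Notation psig := (psig q t).
Local Notation pieri_coef := (pieri_coef q t).
Local Notation Xstrip := (Xstrip q t).

Lemma eq_psig N la la' nu nu' : la =1 la' -> nu =1 nu' -> psig N la nu = psig N la' nu'.
Proof.
move=> E1 E2; rewrite /psig; apply: eq_bigr => i _; apply: eq_bigr => j _.
by rewrite !E1 !E2.
Qed.

Lemma eq_Xstrip N s x la la' nu nu' : la =1 la' -> nu =1 nu' ->
  Xstrip N s x la nu = Xstrip N s x la' nu'.
Proof. by move=> E1 E2; rewrite /Xstrip; apply: eq_bigr => i _; rewrite E1 E2. Qed.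

Lemma eq_interlace la la' nu nu' : la =1 la' -> nu =1 nu' ->
  interlace la nu -> interlace la' nu'.
Proof. by move=> E1 E2 h i; rewrite -!E1 -E2. Qed.

Variable N : nat.
Implicit Types (la nu : 'X_{1..N.+1}) (v : 'X_{1..N.+1} -> K) (s x : K).

Definition weight s x la nu := psig N (rowlen la) (rowlen nu) * Xstrip N s x (rowlen la) (rowlen nu).

Definition transfer s x v la := \sum_(nu <- strips la) weight s x la nu * v nu.

(** The weight extended by 0 to pairs that do not interlace: the full matrix of the transfer
    operator. *)
Definition tmat s x la nu := (interl la nu)%:R * weight s x la nu.

Lemma transferE b s x v la : (mdeg la < b)%N ->
  transfer s x v la = \sum_(nu <- mnm_below N.+1 b) tmat s x la nu * v nu.
Proof.
move=> lab; rewrite (bigID (fun nu => interl la nu)) /= [X in _ + X]big1 ?addr0.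
  have E : perm_eq (strips la) [seq nu <- mnm_below N.+1 b | interl la nu].
    apply: uniq_perm; rewrite ?strips_uniq ?filter_uniq ?mnm_below_uniq // => nu.
    rewrite mem_strips mem_filter mem_mnm_below; case: (boolP (interl la nu)) => //=.
    by move/interl_mdeg => h; rewrite (leq_ltn_trans h lab).
  rewrite /transfer (perm_big _ E) big_filter /=; apply: eq_bigr => nu h.
  by rewrite /tmat h mul1r.
by move=> nu /negPf h; rewrite /tmat h !mul0r.
Qed.

(* The operator of multiplication by the sum of the variables, acting on
   functions of la. *)
Definition pieri s v la :=
  (\sum_(i < N.+1) gbracket s (la i) i) * v la
  + \sum_(p < N.+1) pieri_coef (rowlen la) p * v (la + U_(p))%MM.

(** [psig_up] together with the bracket of the added square; if la + e_p does not interlace with nu,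
    both sides are 0 by [pieri_up_eq0]. *)
Lemma tmat_interl s x la nu (p : 'I_N.+1) : interl la nu ->
  pieri_coef (rowlen la) p * tmat s x (la + U_(p))%MM nu =
  pieri_up q t (fun i : 'I_N.+1 => pnt q t (rowlen la i) i)
    (fun j : 'I_N => pnt q t (rowlen nu j) j) p * (x - gbracket s (la p) p) * tmat s x la nu.
Proof.
move=> I1; rewrite /tmat I1 mul1r; have I1' := elimT (interlP _ _) I1.
case: (boolP (interl (la + U_(p)) nu)) => I2.
  rewrite mul1r /weight.
  have I2' := eq_interlace (row_addU la p) (fun=> erefl) (elimT (interlP _ _) I2).
  rewrite (eq_psig _ (row_addU la p) (fun=> erefl)) (eq_Xstrip _ _ _ (row_addU la p) (fun=> erefl)).
  rewrite mulrA (psig_up gen I1' I2') Xstrip_incr //; last by case/andP: (I1' p).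
  by rewrite row_ord; ring.
rewrite mul0r mulr0 pieri_up_eq0 ?mul0r // => I3; case/negP: I2; apply/interlP.
by apply: eq_interlace I3 => // i; rewrite row_addU.
Qed.

(** The counterpart for removing a square from nu, by [psig_down] and [pieri_down_eq0]. The
    indicator guards against the truncated subtraction in [nu - U_(p)]. *)
Lemma tmat_interl_sub s x la nu (p : 'I_N.+1) (p' : 'I_N) : p = p' :> nat -> interl la nu ->
  (0 < nu p)%N%:R * (tmat s x la (nu - U_(p))%MM * pieri_coef (rowlen (nu - U_(p))%MM) p) =
  pieri_down q t (fun i : 'I_N.+1 => pnt q t (rowlen la i) i)
    (fun j : 'I_N => pnt q t (rowlen nu j) j) p' * (x - gbracket s (nu p).-1 p) * tmat s x la nu.
Proof.
move=> pp' I1; have I1' := elimT (interlP _ _) I1.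
case: (ltnP (rowlen la p.+1) (nu p)) => [h|h]; last first.
  have E : rowlen la p.+1 = nu p by have := I1' p; rewrite row_ord; lia.
  rewrite pieri_down_eq0 ?mul0r -?pp' ?row_ord //.
  case: (posnP (nu p)) => np; rewrite ?mul0r // mul1r /tmat.
  suff -> : interl la (nu - U_(p)) = false by rewrite !mul0r.
  apply/interlP => /(_ p); rewrite row_ord E mnmBE mnm1E eqxx; lia.
have np : (0 < nu p)%N by apply: leq_ltn_trans h.
rewrite np mul1r.
have rE := row_subU np; set ka := (nu - U_(p))%MM in rE *.
have kap : nu p = (rowlen ka p).+1 by rewrite -row_ord rE incr_eq.
have I2 : interlace (rowlen la) (rowlen ka).
  move=> i; have := I1' i; rewrite rE.
  case: (eqVneq i p) => [->|ip]; last by rewrite incr_neq.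
  by rewrite incr_eq; move: h; rewrite kap; lia.
have I3 : interlace (rowlen la) (incr (rowlen ka) p') by rewrite -pp';
  apply: eq_interlace I1'.
rewrite /tmat I1 (introT (interlP _ _) I2) !mul1r /weight.
rewrite (@Xstrip_decr _ q t N s x _ (rowlen ka) p) //; last first.
  by have := I1' p; rewrite rE incr_eq; lia.
rewrite (eq_psig _ (fun=> erefl) rE) (eq_Xstrip _ _ _ (fun=> erefl) rE) kap /=.
have := psig_down gen I2 I3; rewrite -pp' => E.
transitivity (pieri_coef (rowlen ka) p * psig N (rowlen la) (rowlen ka) *
  (Xstrip N s x (rowlen la) (incr (rowlen ka) p) * (x - gbracket s (rowlen ka p) p)));
    first by ring.
rewrite E.
have -> : pieri_down q t (fun i : 'I_N.+1 => pnt q t (rowlen la i) i)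
  (fun j : 'I_N => pnt q t (rowlen nu j) j) p' = pieri_down q t (fun i : 'I_N.+1 => pnt q t (rowlen la i) i)
  (fun j : 'I_N => pnt q t (incr (rowlen ka) p j) j) p'.
  rewrite /pieri_down; congr (_ * _ * _); first by rewrite rE.
  by apply: eq_bigr => j _; rewrite !rE.
by ring.
Qed.

(** For a pair that does not interlace, one square can help only in the situation of
    [psig_boundary]; in all other cases both sides vanish. *)
Lemma tmat_not_interl s x la nu (p : 'I_N.+1) :
  (forall i, (rowlen la i.+1 <= rowlen la i)%N) -> rowlen nu N = 0%N -> ~~ interl la nu ->
  pieri_coef (rowlen la) p * tmat s x (la + U_(p))%MM nu =
  (0 < nu p)%N%:R * (tmat s x la (nu - U_(p))%MM * pieri_coef (rowlen (nu - U_(p))%MM) p).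
Proof.
move=> la_part nuN nI.
(* Lengthening row p of la can only repair a failure in row p, and only if nu_p exceeds la_p by
   1. *)
have fail_at (i : nat) : ~~ (rowlen la i.+1 <= rowlen nu i <= rowlen la i)%N -> interlace (incr (rowlen la) p) (rowlen nu) ->
    i = p /\ rowlen nu p = (rowlen la p).+1.
  move=> h /(_ i); rewrite /incr; move: h.
  case: (eqVneq i p) => [->|ip]; last by case: (eqVneq i.+1 p) => _; lia.
  by rewrite (_ : (p.+1 == p) = false) ?gtn_eqF //; lia.
have [i ni] : exists i : 'I_N.+1, ~~ (rowlen la i.+1 <= rowlen nu i <= rowlen la i)%N.
  by move: nI; rewrite negb_forall => /existsP [i]; rewrite -!row_ord; exists i.
case: (boolP (interl (la + U_(p)) nu)) => I2.
  have I2' := eq_interlace (row_addU la p) (fun=> erefl) (elimT (interlP _ _) I2).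
  have [ip nup] := fail_at i ni I2'.
  have np : (0 < nu p)%N by rewrite -row_ord nup.
  have pN : (p < N)%N.
    have := ltn_ord p; rewrite ltnS leq_eqVlt => /orP[/eqP pN|//].
    by move: nup; rewrite pN nuN.
  have rE := row_subU np; set ka := (nu - U_(p))%MM in rE *.
  have kap : rowlen la p = rowlen ka p by move: nup; rewrite rE incr_eq => -[].
  have I3 : interlace (rowlen la) (rowlen ka).
    move=> j; have := I2' j; rewrite rE.
    case: (eqVneq j p) => [->|jp]; first by rewrite -kap la_part leqnn.
    by rewrite !(incr_neq _ jp) /incr; case: eqP; lia.
  have I2'' : interlace (incr (rowlen la) p) (incr (rowlen ka) p) by apply: eq_interlace I2'.
  rewrite np mul1r /tmat I2 (introT (interlP _ _) I3) !mul1r /weight.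
  rewrite (eq_psig _ (row_addU la p) rE) (eq_Xstrip _ _ _ (row_addU la p) rE).
  rewrite Xstrip_boundary //.
  have := @psig_boundary _ _ _ gen N _ _ (Ordinal pN) I3 I2'' kap; rewrite /= => E.
  by rewrite mulrA E; ring.
rewrite /tmat (negPf I2) mul0r mulr0.
case: (posnP (nu p)) => [_|np]; first by rewrite mul0r.
have rE := row_subU np; set ka := (nu - U_(p))%MM in rE *.
case: (boolP (interl la ka)) => I3; last by rewrite !mul0r mulr0.
have I3' := elimT (interlP _ _) I3.
have ip : (i : nat) = p.
  apply/eqP; apply: contraNT ni => ip; have := I3' i; rewrite rE (incr_neq _ ip) //.
have kap : rowlen la p = rowlen ka p.
  have := I3' p; move: ni; rewrite ip rE incr_eq; lia.
suff -> : pieri_coef (rowlen ka) p = 0 by rewrite !mulr0.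
case: (posnP p) => [p0|p0].
  case/negP: I2; apply/interlP => j; rewrite !row_addU rE.
  by have := I3' j; rewrite /incr p0; case: j => [|j] /=; lia.
have ka1 : rowlen ka p.-1 = rowlen ka p.
  apply/eqP; apply: contraNT I2 => ne; apply/interlP => j; rewrite !row_addU rE.
  have := I3' j; have := I3' p.-1; move: ne; rewrite prednK // /incr.
  case: (eqVneq j p) => [->|jp]; first by rewrite (gtn_eqF (ltnSn p)) /=; lia.
  case: (eqVneq j.+1 p) => [E|_] /=; last by lia.
  by move: kap; rewrite -E /=; lia.
(* Rows p-1 and p of ka are equal, so the factor of index p-1 is 0. *)
apply/eqP; rewrite /pieri_coef prodf_seq_eq0; apply/hasP; exists p.-1.
  by rewrite mem_index_iota /= prednK.
rewrite /= ka1.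
have -> : t * pnt q t (rowlen ka p) p = pnt q t (rowlen ka p) p.-1.
  by rewrite -[in LHS](prednK p0) (tpnt gen) prednK.
by rewrite divff ?(pnt_neq0 gen) // subrr !mul0r.
Qed.

(** The relation between [pieri] and [transfer] entry by entry. For interlacing la and nu it is
    [pieri_sums_pnt] times the weight; otherwise only the sums over single squares remain. *)
Lemma tmat_pieri s x la nu :
  (forall i, (rowlen la i.+1 <= rowlen la i)%N) -> rowlen nu N = 0%N ->
  \sum_(p < N.+1) pieri_coef (rowlen la) p * tmat s x (la + U_(p))%MM nu
  + (\sum_(i < N.+1) gbracket s (la i) i) * tmat s x la nu
  = (x + \sum_(i < N) gbracket (s / t) (rowlen nu i) i) * tmat s x la nu
  + \sum_(p < N.+1)
      (0 < nu p)%N%:R * (tmat s x la (nu - U_(p))%MM * pieri_coef (rowlen (nu - U_(p))%MM) p).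
Proof.
move=> la_part nuN; case: (boolP (interl la nu)) => I1; last first.
  rewrite [tmat s x la nu]/tmat (negPf I1) mul0r !mulr0 addr0 add0r.
  by apply: eq_bigr => p _; apply: tmat_not_interl.
under eq_bigr => p _ do rewrite tmat_interl //.
(* The last row of nu is empty, so the removable squares lie in the N rows that carry the points
   n_j. *)
rewrite [X in _ = _ + X]big_ord_recr /=.
have -> : nu ord_max = 0%N by rewrite -row_ord.
rewrite mul0r addr0.
under [X in _ = _ + X]eq_bigr => p _.
  rewrite (@tmat_interl_sub s x la nu (widen_ord (leqnSn N) p) p erefl I1).
  rewrite -[nu (widen_ord _ _)]row_ord /=; over.
rewrite -!mulr_suml.
have := @pieri_sums_pnt _ q t gen N _ _ s x (elimT (interlP _ _) I1).
under [X in X - _]eq_bigr => p _ do rewrite row_ord.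
under [\sum_(i < N.+1) gbracket s _ i]eq_bigr => p _ do rewrite row_ord.
set S1 := \sum_(p < N.+1) _; set S2 := \sum_(p < N) _ => E.
have -> : S1 = S2 + (x - \sum_(i < N.+1) gbracket s (la i) i +
   \sum_(i < N) gbracket (s / t) (rowlen nu i) i) by rewrite -E; ring.
by ring.
Qed.

End Operators.

(** * Moving the Pieri operator through a transfer operator *)

Section Commutation.
Variables (K : fieldType) (q t : K).
Hypothesis gen : forall a b c d, q ^+ a * t ^+ b = q ^+ c * t ^+ d -> a = c /\ b = d.
Local Notation gbracket := (gbracket q t).
Local Notation psig := (psig q t).
Local Notation pieri_coef := (pieri_coef q t).
Local Notation Xstrip := (Xstrip q t).
Local Notation gprod := (gprod q t).
Variable N : nat.
Local Notation transfer := (@transfer K q t N).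
Local Notation pieri := (@pieri K q t N).
Local Notation tmat := (@tmat K q t N).
Implicit Types (la nu mu : 'X_{1..N.+1}) (v : 'X_{1..N.+1} -> K) (s x y : K).

(** [tmat_pieri] summed against v. The constant [gbracket (s / t) 0 N] is the contribution of the
    empty last row, which [pieri (s / t)] counts and [tmat_pieri] does not. *)
Lemma pieri_transfer s x v la :
  (forall i, (rowlen la i.+1 <= rowlen la i)%N) ->
  (forall nu, rowlen nu N != 0%N -> v nu = 0) ->
  pieri s (transfer s x v) la =
  (x - gbracket (s / t) 0 N) * transfer s x v la + transfer s x (pieri (s / t) v) la.
Proof.
move=> la_part v_supp; pose b := (mdeg la).+2.
have lab : (mdeg la < b)%N by rewrite /b.
rewrite /pieri !(transferE _ _ _ _ _ lab).
under [X in _ + X = _]eq_bigr => p _.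
  rewrite (@transferE _ _ _ _ b); last by rewrite mdegD mdeg1 addn1.
  rewrite mulr_sumr; over.
rewrite exchange_big /= mulr_sumr -big_split /=.
transitivity (\sum_(nu <- mnm_below N.+1 b)
  ((x + \sum_(i < N) gbracket (s / t) (rowlen nu i) i) * tmat s x la nu * v nu
   + \sum_(p < N.+1) (0 < nu p)%N%:R *
       (tmat s x la (nu - U_(p))%MM * pieri_coef (rowlen (nu - U_(p))%MM) p) * v nu)).
  apply: eq_bigr => nu _; case: (eqVneq (rowlen nu N) 0%N) => [nuN|nuN]; last first.
    rewrite (v_supp _ nuN) !mulr0 add0r; apply/eqP; rewrite add0r !big1 // => p _;
      rewrite ?mulr0 //.
  rewrite -mulr_suml -mulrDl -tmat_pieri //.
  under [X in _ + X = _]eq_bigr => p _ do rewrite mulrA.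
  by rewrite -mulr_suml mulrA -mulrDl addrC.
rewrite big_split /= mulr_sumr.
under [X in _ = _ + X]eq_bigr => nu _ do rewrite mulrDr mulr_sumr.
rewrite [X in _ = _ + X]big_split /= [RHS]addrA -[X in _ = X + _]big_split /=;
  congr (_ + _).
  apply: eq_bigr => nu _; case: (eqVneq (rowlen nu N) 0%N) => [nuN|nuN]; last first.
    by rewrite (v_supp _ nuN) !mulr0 addr0.
  rewrite big_ord_recr /= -[nu ord_max]row_ord /= nuN.
  by under [\sum_(i < N) gbracket (s / t) (nu _) _]eq_bigr => i _ do rewrite -row_ord; ring.
(* What remains is the reindexing nu -> nu + e_p, which turns removed squares into added ones. *)
rewrite exchange_big [RHS]exchange_big; apply: eq_bigr => p _ /=.
transitivity (\sum_(nu <- mnm_below N.+1 b | (0 < nu p)%N)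
  tmat s x la (nu - U_(p))%MM * pieri_coef (rowlen (nu - U_(p))%MM) p * v nu).
  rewrite [RHS]big_mkcond; apply: eq_bigr => nu _; case: ifP => _; first by rewrite mul1r.
  by rewrite !mul0r.
transitivity (\sum_(nu <- mnm_below N.+1 b.-1)
  tmat s x la nu * (pieri_coef (rowlen nu) p * v (nu + U_(p))%MM)); last first.
  by rewrite -!transferE.
rewrite -big_filter.
have E : perm_eq [seq nu : 'X_{1..N.+1} <- mnm_below N.+1 b | (0 < nu p)%N]
    [seq (nu + U_(p))%MM | nu <- mnm_below N.+1 b.-1].
  apply: uniq_perm; rewrite ?filter_uniq ?mnm_below_uniq //.
    rewrite map_inj_uniq ?mnm_below_uniq // => m1 m2 /(congr1 (fun m => (m - U_(p))%MM)).
    by rewrite !addmK.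
  move=> m; rewrite mem_filter mem_mnm_below; apply/andP/mapP => [[mp mb]|[m' m'b ->]].
    exists (m - U_(p))%MM; last by rewrite subUK.
    by rewrite mem_mnm_below -(ltn_add2r (mdeg (U_(p) : 'X_{1..N.+1}))) -mdegD subUK // mdeg1 addn1.
  by move: m'b; rewrite mem_mnm_below mnmDE mnm1E eqxx mdegD mdeg1 /b addn1 !ltnS addn1.
rewrite (perm_big _ E) big_map /=; apply: eq_bigr => nu _.
by rewrite addmK mulrA.
Qed.
End Commutation.

(** * Stripping the first row when the first two rows are equal *)

Section EqualRows.
Variables (K : fieldType) (q t : K).
Hypothesis gen : forall a b c d, q ^+ a * t ^+ b = q ^+ c * t ^+ d -> a = c /\ b = d.
Local Notation psig := (psig q t).
Local Notation Xstrip := (Xstrip q t).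
Local Notation gprod := (gprod q t).
Local Notation gbracket := (gbracket q t).

Lemma gprod_shift a b i j m : gprod a b i.+1 j.+1 m = gprod a b i j m.
Proof.
apply: eq_bigr => k _; rewrite /g1 !pntSr.
have t0 := generic_t_neq0 gen; have p0 := pnt_neq0 gen m j.
suff E c : c * (pnt q t k i / t) / (pnt q t m j / t) = c * pnt q t k i / pnt q t m j.
  by rewrite !E.
by field; rewrite t0 p0.
Qed.

(** The factors depend on the row indices only through j - i; the new column j = N contributes 1
    since nu_N = la_{N+1} = 0. *)
Lemma psig_shift N (la nu : nat -> nat) : interlace la nu -> nu N = 0%N ->
  \prod_(1 <= i < N.+2) \prod_(i <= j < N.+1)
    (gprod (nu i.-1) (la i.-1) i j (nu j.-1) / gprod (nu i.-1) (la i.-1) i j (la j))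
  = psig N.+1 la nu.
Proof.
move=> I1 nuN; have la1 : la N.+1 = 0%N by have := I1 N; lia.
rewrite big_add1 /= /psig [RHS]big_nat_recr //= [X in _ = _ * X]big_geq // mulr1.
apply: eq_big_nat => i /andP[_ iN].
rewrite big_add1 /= [RHS]big_nat_recr //= nuN la1 divff ?mulr1; last first.
  by apply: (gprod_neq0 gen) => // k /andP[k1 _].
by apply: eq_bigr => j _; rewrite !gprod_shift.
Qed.

Definition ftail (la : nat -> nat) := fun i => la i.+1.
Definition fcons m (la : nat -> nat) := fun i => if i is i'.+1 then la i' else m.

Lemma psig_row0 N (la nu : nat -> nat) : interlace la nu -> nu N.+1 = 0%N ->
  psig N.+1 la nu =
  \prod_(0 <= j < N.+1) (gprod (nu 0%N) (la 0%N) 0 j (nu j)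
     / gprod (nu 0%N) (la 0%N) 0 j (la j.+1))
  * psig N.+1 (ftail la) (ftail nu).
Proof.
move=> I1 nuN; rewrite -(@psig_shift _ (ftail la)) //; last by move=> i; apply: I1.
rewrite /psig big_ltn //; congr (_ * _).
apply: eq_big_nat => i /andP[i1 _]; apply: eq_big_nat => j /andP[ij _].
by rewrite /ftail !prednK // (leq_trans i1 ij).
Qed.

(* When la_0 = la_1 the first row of nu is forced to be la_0; removing it, and the
   first row m of mu, turns la into (m, la_2, la_3, ...). *)
Definition equal_rows_coef N (la mu : nat -> nat) : K :=
  \prod_(0 <= j < N) (gprod (mu 0%N) (la 0%N) 0 j (mu j)
                      / gprod (mu 0%N) (la 0%N) 0 j (la j.+2)).

(** Since nu_0 = la_0, row 0 of la/nu is empty. Row 1 of la/nu is cut at column mu_0: the left part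
    is the first row of (mu_0, la_2, ...)/(nu_1, ...), and in the right part the factors with
    nu_{j+1} cancel against row 0 of nu/mu. The remaining coefficient is free of nu. *)
Lemma psig_equal_rows N (la nu mu : nat -> nat) :
  interlace la nu -> interlace nu mu -> la 0%N = la 1%N ->
  nu N.+1 = 0%N -> mu N.+1 = 0%N ->
  psig N.+1 la nu * psig N.+1 nu mu =
  equal_rows_coef N.+1 la mu
  * (psig N.+1 (fcons (mu 0%N) (ftail (ftail la))) (ftail nu)
     * psig N.+1 (ftail nu) (ftail mu)).
Proof.
move=> I1 I2 la01 nuN muN.
have nu0 : nu 0%N = la 0%N by have := I1 0%N; lia.
rewrite (psig_row0 I1 nuN) (psig_row0 I2 muN) nu0.
rewrite [X in X * psig N.+1 (ftail la) _]big1 ?mul1r; last first.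
  by move=> j _; rewrite /gprod !big_geq // divr1.
have -> : psig N.+1 (ftail la) (ftail nu) =
  psig N.+1 (fcons (mu 0%N) (ftail (ftail la))) (ftail nu)
  * \prod_(0 <= j < N.+1) (gprod (mu 0%N) (la 0%N) 0 j (nu j.+1)
     / gprod (mu 0%N) (la 0%N) 0 j (la j.+2)).
  apply: (prod_update (j0 := 0%N)) => //; last by move=> [].
  rewrite -big_split; apply: eq_big_nat => j _ /=.
  rewrite /gprod /ftail -la01.
  have h1 : (nu 1%N <= mu 0%N)%N by case/andP: (I2 0%N).
  have h2 : (mu 0%N <= la 0%N)%N by rewrite -nu0; case/andP: (I2 0%N).
  by rewrite !(big_cat_nat h1 h2) /= invfM; ring.
rewrite /equal_rows_coef.
set P := psig _ _ (ftail nu); set R := psig _ _ (ftail mu).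
transitivity (P * R * \prod_(0 <= j < N.+1)
  ((gprod (mu 0%N) (la 0%N) 0 j (nu j.+1) / gprod (mu 0%N) (la 0%N) 0 j (la j.+2))
   * (gprod (mu 0%N) (la 0%N) 0 j (mu j) / gprod (mu 0%N) (la 0%N) 0 j (nu j.+1)))).
  by rewrite [X in _ = _ * X]big_split /=; ring.
rewrite mulrC; congr (_ * _); apply: eq_big_nat => j _.
have n0 : gprod (mu 0%N) (la 0%N) 0 j (nu j.+1) != 0.
  apply: (gprod_neq0 gen) => // k /andP[k1 _]; case: j => [|j]; rewrite ?orbT // orbF.
  by apply/eqP; have := I2 0%N; lia.
by rewrite mulrC mulrA divfK.
Qed.

Lemma Xstrip_row0 N s x (la nu : nat -> nat) : interlace la nu -> la N.+1 = 0%N ->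
  Xstrip N s x la nu = (\prod_(nu 0%N <= k < la 0%N) (x - gbracket s k 0))
   * Xstrip N (s / t) x (ftail la) (ftail nu).
Proof.
move=> I1 laN; rewrite /Xstrip big_ltn // big_add1 /=; congr (_ * _).
rewrite [RHS]big_nat_recr //= [X in _ = _ * X]big_geq ?mulr1; last by rewrite /ftail laN.
apply: eq_bigr => i _; apply: eq_bigr => k _.
by rewrite gbracket_shift.
Qed.

(** With the same cut, columns mu_0 to la_0 occur in row 1 of la/nu with s and in row 0 of nu/mu
    with s/t, hence with equal brackets; their factor is symmetric in x and y. *)
Lemma Xstrip_equal_rows N s x y (la nu mu : nat -> nat) :
  interlace la nu -> interlace nu mu -> la 0%N = la 1%N -> la N.+1 = 0%N ->
  Xstrip N s x la nu * Xstrip N (s / t) y nu mu =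
  (\prod_(mu 0%N <= k < la 0%N) ((x - gbracket s k 1) * (y - gbracket s k 1)))
  * (Xstrip N (s / t) x (fcons (mu 0%N) (ftail (ftail la))) (ftail nu)
     * Xstrip N (s / t / t) y (ftail nu) (ftail mu)).
Proof.
move=> I1 I2 la01 laN.
have nu0 : nu 0%N = la 0%N by have := I1 0%N; lia.
have nuN : nu N.+1 = 0%N by have := I1 N.+1; lia.
rewrite (Xstrip_row0 _ _ I1 laN) (Xstrip_row0 _ _ I2 nuN) nu0 [\prod_(la 0%N <= k < la 0%N) _]big_geq // mul1r.
have -> : Xstrip N (s / t) x (ftail la) (ftail nu) =
  Xstrip N (s / t) x (fcons (mu 0%N) (ftail (ftail la))) (ftail nu)
  * \prod_(mu 0%N <= k < la 0%N) (x - gbracket s k 1).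
  apply: (prod_update (j0 := 0%N)) => //; last by move=> [].
  have h1 : (nu 1%N <= mu 0%N)%N by case/andP: (I2 0%N).
  have h2 : (mu 0%N <= la 0%N)%N by rewrite -nu0; case/andP: (I2 0%N).
  rewrite /ftail -la01 (big_cat_nat h1 h2) /=; congr (_ * _).
  by apply: eq_bigr => k _; rewrite gbracket_shift.
under [\prod_(_ <= _ < _) (y - _)]eq_bigr => k _ do rewrite -gbracket_shift.
by rewrite big_split /=; ring.
Qed.

End EqualRows.

(** * Horizontal strips after adding or removing a first row *)

Section ConsTail.
Variable N : nat.
Implicit Types la nu mu : 'X_{1..N.+1}.

Definition mtail la : 'X_{1..N.+1} := [multinom rowlen la i.+1 | i < N.+1].
Definition mcons m la : 'X_{1..N.+1} := [multinom fcons m (rowlen la) i | i < N.+1].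

Lemma row_mtail la : rowlen (mtail la) =1 ftail (rowlen la).
Proof.
move=> i; rewrite (row_multinom _ (fun i => rowlen la i.+1)); case: ltnP => // h.
by rewrite /ftail row_over // leqW.
Qed.

Lemma row_mcons m la i : (i < N.+1)%N -> rowlen (mcons m la) i = fcons m (rowlen la) i.
Proof. by move=> h; rewrite (row_multinom _ (fcons m (rowlen la))) h. Qed.

Lemma row_mcons0 m la : rowlen la N = 0%N -> rowlen (mcons m la) =1 fcons m (rowlen la).
Proof.
move=> laN i; case: (ltnP i N.+1) => [|h]; first exact: row_mcons.
rewrite row_over //; case: i h => // i; rewrite ltnS leq_eqVlt => /orP[/eqP <-|h] //=.
by rewrite row_over.
Qed.

Lemma mconsK la : mcons (rowlen la 0) (mtail la) = la.
Proof.
apply: row_inj => i; case: (ltnP i N.+1) => h; last by rewrite !row_over.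
by rewrite row_mcons //; case: i h => //= i h; rewrite row_mtail.
Qed.

Lemma mtailK m la : rowlen la N = 0%N -> mtail (mcons m la) = la.
Proof. by move=> laN; apply: row_inj => i; rewrite row_mtail /ftail row_mcons0. Qed.

Lemma interl_last la nu : interl la nu -> rowlen la N = 0%N -> rowlen nu N = 0%N.
Proof. by move/interlP => /(_ N); lia. Qed.

Lemma row_mtail_last la : rowlen (mtail la) N = 0%N.
Proof. by rewrite row_mtail /ftail row_over. Qed.

Lemma perm_strips_cons m nu : rowlen nu N = 0%N -> (rowlen nu 0 <= m)%N ->
  perm_eq (strips (mcons m nu)) 
    [seq mcons k mu | k <- index_iota (rowlen nu 0) m.+1, mu <- strips nu].
Proof.
move=> nuN num; apply: uniq_perm; first exact: strips_uniq.
  apply: allpairs_uniq; rewrite ?iota_uniq ?strips_uniq //.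
  move=> [k1 mu1] [k2 mu2] /allpairsP [[a1 b1] /= [_ h1 [-> ->]]].
  move=> /allpairsP [[a2 b2] /= [_ h2 [-> ->]]] /= E.
  have E0 : a1 = a2 by move/(congr1 (fun m => rowlen m 0)): E; rewrite !row_mcons.
  rewrite E0; congr (_, _); move/(congr1 mtail): E.
  by rewrite !mtailK //; [apply: (interl_last _ nuN)|apply: (interl_last _ nuN)];
    rewrite -mem_strips.
move=> mu; rewrite mem_strips; apply/interlP/allpairsP => [h|[[k mu'] /= [hk hmu ->]]].
  exists (rowlen mu 0, mtail mu); rewrite mconsK mem_index_iota mem_strips; split=> //=.
    by have := h 0%N; rewrite !row_mcons0 //= ltnS.
  apply/interlP => i; rewrite !row_mtail /ftail.
  by have := h i.+1; rewrite !row_mcons0.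
move: hmu hk; rewrite mem_strips mem_index_iota => hmu hk.
have muN := interl_last hmu nuN.
move=> i; rewrite !row_mcons0 //; case: i => [|i] /=; first lia.
exact: (elimT (interlP _ _) hmu).
Qed.

Lemma perm_strips_equal_rows la : (0 < N)%N -> rowlen la 0 = rowlen la 1 ->
  perm_eq (strips la) [seq mcons (rowlen la 0) nu | nu <- strips (mtail la)].
Proof.
move=> N_gt0 la01; have laN := row_mtail_last la.
apply: uniq_perm; first exact: strips_uniq.
  rewrite map_inj_in_uniq ?strips_uniq // => m1 m2; rewrite !mem_strips => h1 h2 E.
  by rewrite -(mtailK (rowlen la 0) (interl_last h1 laN)) E (mtailK _ (interl_last h2 laN)).
move=> nu; rewrite mem_strips; apply/idP/mapP => [h|[nu' h ->]].
  have h' := elimT (interlP _ _) h.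
  exists (mtail nu); last by rewrite -{1}(mconsK nu); congr mcons; have := h' 0%N; lia.
  by rewrite mem_strips; apply/interlP => i; rewrite !row_mtail; apply: h'.
move: h; rewrite mem_strips => h; apply/interlP => i.
rewrite row_mcons0 ?(interl_last h) //; case: i => [|i] /=; first by rewrite la01 leqnn.
by have := elimT (interlP _ _) h i; rewrite !row_mtail.
Qed.

(** This permits fixing m = mu_0 first and then summing over nu as strips of (m, la_2, la_3,
    ...). *)
Lemma strips_bound la m : (rowlen la 2 <= m <= rowlen la 1)%N ->
  perm_eq [seq nu <- strips (mtail la) | (rowlen nu 0 <= m)%N]
    (strips (mcons m (mtail (mtail la)))).
Proof.
move=> hm; apply: uniq_perm; [exact: filter_uniq (strips_uniq _)|exact: strips_uniq|] => nu.
rewrite mem_filter !mem_strips; apply/andP/interlP => [[nu0 /interlP h] i|h].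
  rewrite !row_mcons0 ?row_mtail_last //; have := h i; rewrite !row_mtail /ftail.
  by case: i => [|i] /=; rewrite !row_mtail /ftail ?row_mtail /ftail; lia.
split.
  by have := h 0%N; rewrite !row_mcons0 ?row_mtail_last //=; case/andP.
apply/interlP => i; have := h i; rewrite !row_mcons0 ?row_mtail_last // !row_mtail /ftail.
by case: i => [|i] /=; rewrite !row_mtail /ftail ?row_mtail /ftail; lia.
Qed.

Lemma strips_bound0 la m : (m < rowlen la 2)%N ->
  strips (mcons m (mtail (mtail la))) = [::].
Proof.
move=> hm; case E: (strips _) => [//|nu r]; have := mem_head nu r; rewrite -E.
rewrite mem_strips => /interlP /(_ 0%N); rewrite !row_mcons0 ?row_mtail_last //=.
by rewrite row_mtail /ftail row_mtail /ftail; lia.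
Qed.

End ConsTail.

(** * Commutation of the transfer operators *)

Section TransferC.
Variables (K : fieldType) (q t : K).
Hypothesis gen : forall a b c d, q ^+ a * t ^+ b = q ^+ c * t ^+ d -> a = c /\ b = d.
Local Notation gbracket := (gbracket q t).
Variable N : nat.
Local Notation transfer := (@transfer K q t N.+1).
Local Notation pieri := (@pieri K q t N.+1).
Local Notation weight := (@weight K q t N.+1).
Implicit Types (la nu mu : 'X_{1..N.+2}) (v : 'X_{1..N.+2} -> K) (s x y : K).

(** Two transfer operators create at most two new rows, so functions with this support never outgrow
    the N+2 rows available. *)
Definition supp2 v := forall mu, (rowlen mu N != 0%N) || (rowlen mu N.+1 != 0%N) -> v mu = 0.

(* [mcons] forgets the last row, hence the indicator. *)
Definition first_row_slice la m v mu : K :=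
  (rowlen mu N.+1 == 0%N)%:R * equal_rows_coef q t N.+1 (rowlen la) (fcons m (rowlen mu))
  * v (mcons m mu).

Lemma weight_equal_rows s x y v la m nu mu :
  supp2 v -> rowlen la 0 = rowlen la 1 -> (m <= rowlen la 0)%N ->
  interl la (mcons (rowlen la 0) nu) ->
  rowlen nu N.+1 = 0%N -> (rowlen nu 0 <= m)%N -> interl nu mu ->
  weight s x la (mcons (rowlen la 0) nu) *
    (weight (s / t) y (mcons (rowlen la 0) nu) (mcons m mu) * v (mcons m mu)) =
  (\prod_(m <= k < rowlen la 0) ((x - gbracket s k 1) * (y - gbracket s k 1))) *
  (weight (s / t) x (mcons m (mtail (mtail la))) nu *
    (weight (s / t / t) y nu mu * first_row_slice la m v mu)).
Proof.
move=> v_supp la01 mL Ila nuN num Imu; rewrite /first_row_slice.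
have muN := interl_last Imu nuN; rewrite muN eqxx mul1r.
(* Where v is nonzero, its support makes the last rows of mu and nu empty, as the stripping lemmas
   require. *)
have [v0|v0] := eqVneq (v (mcons m mu)) 0; first by rewrite v0 !mulr0.
have nu_c := row_mcons0 (rowlen la 0) nuN; have mu_c := row_mcons0 m muN.
have muN' : rowlen mu N = 0%N.
  apply/eqP; apply: contraNT v0 => h; apply/eqP/v_supp; rewrite !row_mcons0 //=.
  by rewrite h orbT.
have Inu : interlace (fcons (rowlen la 0) (rowlen nu)) (fcons m (rowlen mu)).
  by move=> [|i] /=; [rewrite num|exact: (elimT (interlP _ _) Imu)].
have Ila' : interlace (rowlen la) (fcons (rowlen la 0) (rowlen nu)).
  by apply: eq_interlace (elimT (interlP _ _) Ila) => //; apply: row_mcons0.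
have nuN' : rowlen nu N = 0%N.
  have [z1 z2] : rowlen mu N = 0%N /\ fcons m (rowlen mu) N = 0%N; last first.
    by have := Inu N; rewrite z2 /=; lia.
  split=> //; apply/eqP; apply: contraNT v0 => h; apply/eqP/v_supp.
  by rewrite !row_mcons0 // h.
rewrite /weight.
have la_c : rowlen (mcons m (mtail (mtail la))) =1 fcons m (ftail (ftail (rowlen la))).
  move=> i; rewrite row_mcons0 ?row_mtail_last //; case: i => //= i.
  by rewrite row_mtail /ftail row_mtail.
rewrite (eq_psig q t _ (fun=> erefl) nu_c) (eq_psig q t _ nu_c mu_c).
rewrite (eq_Xstrip q t _ _ _ (fun=> erefl) nu_c) (eq_Xstrip q t _ _ _ nu_c mu_c).
rewrite (eq_psig q t _ la_c (fun=> erefl)) (eq_Xstrip q t _ _ _ la_c (fun=> erefl)).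
have laN : rowlen la N.+2 = 0%N by rewrite row_over.
have E1 := psig_equal_rows gen Ila' Inu la01 nuN' muN'.
have E2 := @Xstrip_equal_rows _ q t N.+1 s x y _ _ _ Ila' Inu la01 laN.
rewrite /= in E1 E2.
rewrite -[ftail (fcons (rowlen la 0) (rowlen nu))]/(rowlen nu) in E1 E2.
rewrite -[ftail (fcons m (rowlen mu))]/(rowlen mu) in E1 E2.
set p1 := psig _ _ _ _ _ in E1 *; set p2 := psig _ _ _ _ _ in E1 *.
set p3 := psig _ _ _ _ _ in E1 *; set p4 := psig _ _ _ _ _ in E1 *.
set X1 := Xstrip _ _ _ _ _ _ _ in E2 *; set X2 := Xstrip _ _ _ _ _ _ _ in E2 *.
set X3 := Xstrip _ _ _ _ _ _ _ in E2 *; set X4 := Xstrip _ _ _ _ _ _ _ in E2 *.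
transitivity ((p1 * p2) * (X1 * X2) * v (mcons m mu)); first by ring.
by rewrite E1 E2; ring.
Qed.

(** The double sum over nu and mu is grouped by m = mu_0, and [weight_equal_rows] is applied term by
    term. *)
Lemma transfer_equal_rows s x y v la :
  supp2 v -> rowlen la 0 = rowlen la 1 ->
  transfer s x (transfer (s / t) y v) la =
  \sum_(0 <= m < (rowlen la 0).+1)
    (\prod_(m <= k < rowlen la 0) ((x - gbracket s k 1) * (y - gbracket s k 1))) *
    transfer (s / t) x (transfer (s / t / t) y (first_row_slice la m v))
      (mcons m (mtail (mtail la))).
Proof.
move=> v_supp la01.
rewrite {1}/transfer (perm_big _ (perm_strips_equal_rows (ltn0Sn _) la01)) big_map /=.
have lat := row_mtail_last la.
transitivity (\sum_(nu <- strips (mtail la)) \sum_(0 <= m < (rowlen la 0).+1)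
  if (rowlen nu 0 <= m)%N then \sum_(mu <- strips nu)
    weight s x la (mcons (rowlen la 0) nu) *
    (weight (s / t) y (mcons (rowlen la 0) nu) (mcons m mu) * v (mcons m mu)) else 0).
  rewrite big_seq [RHS]big_seq; apply: eq_bigr => nu; rewrite mem_strips => hnu.
  have nuN := interl_last hnu lat.
  have nu0 : (rowlen nu 0 <= rowlen la 0)%N.
    by have := elimT (interlP _ _) hnu 0%N; rewrite la01 !row_mtail /ftail; case/andP.
  rewrite -big_mkcond /transfer (perm_big _ (perm_strips_cons nuN nu0)) /=.
  rewrite big_allpairs_dep mulr_sumr (big_nat_widenl _ 0%N) //=.
  by apply: eq_bigr => k _; rewrite mulr_sumr.
rewrite exchange_big /=; apply: eq_big_nat => m /andP[_ mL].
rewrite -big_mkcond /= -big_filter.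
(* For m < la_2 both sides are empty sums: nu would need la_2 <= nu_0 <= m, and (m, la_2, ...) is
   not decreasing. *)
have [h2|h2] := ltnP m (rowlen la 2).
  rewrite /transfer (strips_bound0 h2) big_nil mulr0.
  rewrite big_filter big_seq_cond big_pred0 // => nu; apply/negP => /andP[].
  rewrite mem_strips => /interlP /(_ 0%N); rewrite !row_mtail /ftail; lia.
rewrite (perm_big _ (strips_bound _)) /=; last by rewrite h2 -la01.
rewrite [in RHS]/transfer mulr_sumr big_seq [RHS]big_seq; apply: eq_bigr => nu.
rewrite -(perm_mem (strips_bound _)) ?h2 -?la01 // mem_filter mem_strips => /andP[nu0 hnu].
have nuN := interl_last hnu lat.
rewrite /transfer mulr_sumr mulr_sumr big_seq [RHS]big_seq; apply: eq_bigr => mu.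
rewrite mem_strips => hmu; apply: weight_equal_rows => //.
rewrite -mem_strips (perm_mem (perm_strips_equal_rows (ltn0Sn _) la01)).
by apply/mapP; exists nu; rewrite ?mem_strips.
Qed.

Lemma pieri_supp2 s v : supp2 v -> supp2 (pieri s v).
Proof.
move=> h mu hmu; rewrite /pieri h // mulr0 add0r big1 // => p _.
rewrite h ?mulr0 // !row_addU /incr; move: hmu; lia.
Qed.

Lemma transfer_supp s x v nu : supp2 v -> rowlen nu N.+1 != 0%N -> transfer s x v nu = 0.
Proof.
move=> h nuN; rewrite /transfer big_seq big1 // => mu;
  rewrite mem_strips => /interlP /(_ N) hm.
by rewrite h ?mulr0 //; apply/orP; left; move: nuN hm; lia.
Qed.

Lemma first_row_slice_supp2 la m v : supp2 v -> supp2 (first_row_slice la m v).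
Proof.
move=> h mu hm; rewrite /first_row_slice.
have [E|_] := eqVneq (rowlen mu N.+1) 0%N; last by rewrite !mul0r.
by rewrite h ?mulr0 // !row_mcons //=; move: hm; rewrite E orbF => ->; rewrite orbT.
Qed.

Lemma transfer_nonpart s x v la : ~ (forall i, (rowlen la i.+1 <= rowlen la i)%N) ->
  transfer s x v la = 0.
Proof.
move=> h; rewrite /transfer big_seq big1 // => nu; rewrite mem_strips => /interlP hn.
by case: h => i; have := hn i; lia.
Qed.

Lemma pieri_coef_row0 (la : nat -> nat) : pieri_coef q t la 0 = 1.
Proof. by rewrite /pieri_coef big_geq. Qed.

Lemma mdeg_row n (m : 'X_{1..n}) : mdeg m = (\sum_(0 <= i < n) rowlen m i)%N.
Proof. by rewrite mdegE big_mkord; apply: eq_bigr => i _; rewrite row_ord. Qed.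

Lemma mdeg_slice la m : rowlen la 0 = rowlen la 1 -> (0 < rowlen la 0)%N -> (m <= rowlen la 0)%N ->
  (mdeg (mcons m (mtail (mtail la))) < mdeg la)%N.
Proof.
move=> la01 la0 mL;
  rewrite !mdeg_row (@big_ltn _ _ _ 0) // [X in (_ < X)%N]big_ltn // row_mcons //=.
rewrite [X in (_ < _ + X)%N]big_ltn // big_add1 /= [X in (_ < _ + (_ + X))%N]big_add1 /=.
rewrite [X in (_ < _ + (_ + X))%N]big_add1 /=.
have -> : (\sum_(0 <= i < N.+1) rowlen (mcons m (mtail (mtail la))) i.+1 = \sum_(0 <= i < N) rowlen la i.+2)%N.
  rewrite big_nat_recr //= row_mcons //= row_mtail /ftail row_mtail_last addn0.
  by apply: eq_big_nat => i /andP[_ iN];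
    rewrite row_mcons ?ltnS ?(ltnW iN) //= row_mtail /ftail row_mtail.
lia.
Qed.

Lemma transfer_empty s x y v w la : rowlen la 0 = 0%N -> (forall i, (rowlen la i.+1 <= rowlen la i)%N) ->
  (forall nu, interl la nu -> v nu = w nu) -> transfer s x v la = transfer s y w la.
Proof.
move=> la0 lap vw; rewrite /transfer big_seq [RHS]big_seq; apply: eq_bigr => nu.
rewrite mem_strips => h; rewrite vw //; congr (_ * _ * _).
have z i : rowlen la i = 0%N by elim: i => // i IH; have := lap i; lia.
by rewrite /Xstrip !big1 // => i _; rewrite z big_geq.
Qed.

Lemma eq_transfer s x v w la : (forall nu, interl la nu -> v nu = w nu) ->
  transfer s x v la = transfer s x w la.
Proof.
move=> vw; rewrite /transfer big_seq [RHS]big_seq; apply: eq_bigr => nu.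
by rewrite mem_strips => h; rewrite vw.
Qed.

Lemma transfer_lin s x c v w la :
  transfer s x (fun nu => c * v nu + w nu) la = c * transfer s x v la + transfer s x w la.
Proof.
by rewrite /transfer mulr_sumr -big_split; apply: eq_bigr => nu _ /=; ring.
Qed.

(** Outer induction on the size of la, inner induction on the length of its first row, for all s and
    v at once because both change along the way. *)
Lemma transferC s x y v la : supp2 v ->
  transfer s x (transfer (s / t) y v) la = transfer s y (transfer (s / t) x v) la.
Proof.
have [n] := ubnP (mdeg la); elim: n la s v => // n IHn la s v.
have [k] := ubnP (rowlen la 0); elim: k la s v => // k IHk la s v lak lan v_supp.
case: (boolP [forall i : 'I_N.+2, (rowlen la i.+1 <= rowlen la i)%N]) => [/forallP lap|];
  last first.
  move=> /forallP nla;
    have nla' : ~ (forall i, (rowlen la i.+1 <= rowlen la i)%N) by move=> h; apply: nla.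
  by rewrite !transfer_nonpart.
have {}lap i : (rowlen la i.+1 <= rowlen la i)%N.
  by case: (ltnP i N.+2) => h; [exact: (lap (Ordinal h))|rewrite row_over // leqW].
have := lap 0%N; rewrite leq_eqVlt => /orP[/eqP /esym la01|la10].
  (* Both orders become sums over smaller diagrams with scalars symmetric in x and y. *)
  rewrite !transfer_equal_rows //; apply: eq_big_nat => m /andP[_ mL].
  congr (_ * _); first by apply: eq_bigr => j _; rewrite mulrC.
  have [la_gt0|la0] := ltnP 0 (rowlen la 0).
    apply: IHn; last exact: first_row_slice_supp2.
    exact: leq_trans (mdeg_slice la01 la_gt0 mL) lan.
  (* The empty diagram does not get smaller, but there the weights are free of x and y. *)
  have m0 : m = 0%N by lia.
  have zero i : rowlen (mcons m (mtail (mtail la))) i = 0%N.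
    rewrite row_mcons0 ?row_mtail_last // m0; case: i => //= i.
    rewrite row_mtail /ftail row_mtail /ftail.
    have z j : rowlen la j = 0%N by elim: j => [|j IH]; last (have := lap j); lia.
    exact: z.
  apply: transfer_empty => [|i|nu /interlP hnu]; rewrite ?zero //.
  have nu0 i : rowlen nu i = 0%N by have := hnu i; rewrite !zero; lia.
  by apply: transfer_empty => [|i|//]; rewrite ?nu0.
(* With la_0 > la_1 the first row can be shortened; la is recovered from the Pieri operator at
   ka. *)
pose ka := (la - U_(ord0))%MM.
have la0 : (0 < la ord0)%N by rewrite -row_ord /=; lia.
have kaE : (ka + U_(ord0))%MM = la by rewrite subUK.
have rE := row_subU la0; rewrite -/ka in rE.
have kap i : (rowlen ka i.+1 <= rowlen ka i)%N.
  have := lap i; rewrite !rE /incr; case: i => [|i] //=; move: la10; rewrite !rE /incr /=;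
    lia.
have mka : mdeg la = (mdeg ka).+1 by rewrite -kaE mdegD mdeg1 addn1.
pose d v la := transfer s x (transfer (s / t) y v) la - transfer s y (transfer (s / t) x v) la.
(* Passing through both transfer operators costs a scalar symmetric in x' and y'. *)
have expand x' y' : pieri s (transfer s x' (transfer (s / t) y' v)) ka =
   (x' + y' - gbracket (s / t) 0 N.+1 - gbracket (s / t / t) 0 N.+1) * transfer s x' (transfer (s / t) y' v) ka
   + transfer s x' (transfer (s / t) y' (pieri (s / t / t) v)) ka.
  rewrite pieri_transfer //; last by move=> nu; apply: transfer_supp.
  have -> : transfer s x' (pieri (s / t) (transfer (s / t) y' v)) ka =
     (y' - gbracket (s / t / t) 0 N.+1) * transfer s x' (transfer (s / t) y' v) ka
     + transfer s x' (transfer (s / t) y' (pieri (s / t / t) v)) ka.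
    rewrite -transfer_lin; apply: eq_transfer => nu /interlP hnu.
    rewrite pieri_transfer // => [i|]; first by have := hnu i; have := hnu i.+1; lia.
    by move=> mu hmu; apply: v_supp; rewrite hmu orbT.
  by ring.
have IHka w : supp2 w ->
  transfer s x (transfer (s / t) y w) ka = transfer s y (transfer (s / t) x w) ka.
  by move=> hw; apply: IHn => //; rewrite mka in lan.
have pieriE f : pieri s f ka = (\sum_(i < N.+2) gbracket s (ka i) i) * f ka + f la
   + \sum_(i < N.+1) pieri_coef q t (rowlen ka) (lift ord0 i) * f (ka + U_(lift ord0 i))%MM.
  by rewrite /pieri [X in _ + X]big_ord_recl pieri_coef_row0 kaE mul1r addrA.
have := expand x y; have := expand y x; rewrite !pieriE -!IHka //; last exact: pieri_supp2.
set S1 := \sum_(i < N.+1) _; set S2 := \sum_(i < N.+1) _.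
(* These diagrams have the size of la and a first row shorter by 1, so the inner induction
   applies. *)
have <- : S2 = S1.
  apply: eq_bigr => p _; congr (_ * _); apply/IHk => //.
    rewrite row_addU incr_neq //; move: lak; rewrite rE /incr eqxx; lia.
  by rewrite mdegD mdeg1 addn1 -mka.
move=> E1 E2.
set e := \sum_(i < N.+2) _ in E1 E2.
set A := transfer s x _ ka in E1 E2.
set A' := transfer s x _ ka in E1 E2.
apply: (addrI (e * A)); apply: (addIr S2); rewrite E1 E2; ring.
Qed.

End TransferC.

(** * Symmetry, vanishing and non-vanishing *)

Section InterpolationFunction.
Variables (K : fieldType) (q t : K).
Hypothesis gen : forall a b c d, q ^+ a * t ^+ b = q ^+ c * t ^+ d -> a = c /\ b = d.
Local Notation gbracket := (gbracket q t).

Section Definitions.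
Variable N : nat.
Local Notation transfer := (@transfer K q t N).
Implicit Types (la nu mu : 'X_{1..N.+1}) (s x y : K) (xs ys : seq K).

(** The tableau sum at the values [xs], peeled off from value 1 on; everything must be peeled off in
    the end. *)
Fixpoint interp s xs la : K :=
  if xs is x :: xs' then transfer s x (interp (s / t) xs') la else (la == 0%MM)%:R.

(** A horizontal strip takes at most one square from each column, so a diagram with more rows than
    variables is never emptied. *)
Lemma interp_supp s xs la i : (size xs <= i)%N -> rowlen la i != 0%N -> interp s xs la = 0.
Proof.
elim: xs s la i => [|x xs IH] s la i /= hi lai.
  case: eqP => // la0; move: lai; rewrite la0 /rowlen.
  have [h|h] := ltnP i N.+1; last by rewrite -/(rowlen 0%MM i) row_over.
  by rewrite -/(rowlen _ (Ordinal h)) row_ord mnm0E.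
rewrite /transfer big_seq big1 // => nu; rewrite mem_strips => /interlP hn.
case: i hi lai => // i hi lai; rewrite (IH _ _ i) ?mulr0 //.
by have := hn i; lia.
Qed.

Lemma eq_interp_cons s x xs ys la :
  (forall s la, interp s xs la = interp s ys la) ->
  interp s (x :: xs) la = interp s (x :: ys) la.
Proof. by move=> E; rewrite /= /transfer; apply: eq_bigr => nu _; rewrite E. Qed.

End Definitions.

Lemma interp_swap N s x y xs (la : 'X_{1..N.+1}) : (size xs < N)%N ->
  interp s (x :: y :: xs) la = interp s (y :: x :: xs) la.
Proof.
case: N la => // N la h /=; apply: (transferC gen) => mu /orP[hm|hm].
  by apply: interp_supp hm; rewrite -ltnS.
by apply: interp_supp hm; rewrite ltnW.
Qed.

Lemma interp_front N s x xs ys (la : 'X_{1..N.+1}) : (size (xs ++ ys) <= N)%N ->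
  interp s (xs ++ x :: ys) la = interp s (x :: xs ++ ys) la.
Proof.
elim: xs s la => [|y xs IH] s la //= h.
transitivity (interp s (y :: x :: xs ++ ys) la); last exact: interp_swap.
by apply: eq_interp_cons => s' la'; apply: IH; rewrite ltnW.
Qed.

Lemma interp_perm N s xs ys (la : 'X_{1..N.+1}) : (size xs <= N.+1)%N ->
  perm_eq xs ys -> interp s xs la = interp s ys la.
Proof.
elim: xs ys s la => [|x xs IH] ys s la /=.
  by move=> _; rewrite perm_sym => /perm_nilP ->.
move=> h E; have : x \in ys by rewrite -(perm_mem E) mem_head.
move/splitPr => yE; move: E; case: ys / yE => y1 y2 E.
have E2 : perm_eq xs (y1 ++ y2).
  by rewrite -(perm_cons x) (perm_trans E) // perm_catC /= perm_cons perm_catC.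
rewrite interp_front; last by rewrite -(perm_size E2).
by apply: eq_interp_cons => s' la'; apply: IH => //; rewrite ltnW.
Qed.

(* The points ([1, m_1], ..., [n, m_n]); shifting the row index amounts to
   replacing s by s / t. *)
Fixpoint nodes s (ms : seq nat) : seq K :=
  if ms is m :: ms' then gbracket s m 0 :: nodes (s / t) ms' else [::].

Lemma nodesE s ms : nodes s ms = mkseq (fun i => gbracket s (nth 0%N ms i) i) (size ms).
Proof.
elim: ms s => //= m ms IH s;
  rewrite IH /mkseq -[iota 0 (size ms).+1]/(0%N :: iota 1 (size ms)).
rewrite /= (iotaDl 1 0) -map_comp; congr (_ :: _).
by apply: eq_map => i /=; rewrite add1n /= gbracket_shift.
Qed.

(** Some strip la/nu has a nonzero term, and by induction nu is bounded by the tail of [ms].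
    Interlacing bounds the later rows of la, and the value [1, m] of the first variable bounds the
    first one. *)
Lemma interp_vanish N s ms (la : 'X_{1..N.+1}) : sorted geq ms ->
  interp s (nodes s ms) la != 0 -> forall i, (rowlen la i <= nth 0%N ms i)%N.
Proof.
elim: ms s la => [|m ms IH] s la /=.
  move=> _ h i; rewrite nth_nil leqn0; apply: contraTT h => h.
  rewrite negbK -/(interp s [::] la); apply/eqP.
  exact: (@interp_supp N s [::] la i).
move=> ms_sorted; rewrite {1}/transfer => h.
have {h} : exists2 nu, interl la nu & weight q t s (gbracket s m 0) la nu * interp (s / t) (nodes (s / t) ms) nu != 0.
  have [/hasP [nu]|] := boolP (has (fun nu =>
     weight q t s (gbracket s m 0) la nu * interp (s / t) (nodes (s / t) ms) nu != 0) (strips la)).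
    by rewrite mem_strips => h1 h2; exists nu.
  move/hasPn => h2; case/eqP: h; rewrite big_seq big1 // => nu /h2.
  by rewrite negbK => /eqP.
move=> [nu /interlP hn]; rewrite mulf_eq0 negb_or => /andP[w0 F0].
have hnu := IH _ _ (path_sorted ms_sorted) F0.
case=> [|i] /=; last by have := hn i; have := hnu i; lia.
(* Otherwise the square in column m of the first row belongs to the strip, and its factor is 0. *)
rewrite leqNgt; apply: contra w0 => m_lt.
rewrite /weight /Xstrip mulf_eq0; apply/orP; right.
have ms0 : (nth 0%N ms 0 <= m)%N by move: ms_sorted; case: (ms) => //= a r /andP[].
have num : (rowlen nu 0 <= m)%N by apply: leq_trans (hnu 0%N) ms0.
rewrite big_ltn // mulf_eq0; apply/orP; left.
rewrite (big_cat_nat num (ltnW m_lt)) /= [X in _ * X]big_ltn // subrr mul0r mulr0.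
exact: eqxx.
Qed.

(** Two brackets cz + 1/(cz) and cw + 1/(cw) agree only if z = w or c^2 z w = 1; the inequality
    excludes the second case. *)
Definition generic_shift s := s != 0 /\ forall a b, s ^+ 2 * q ^+ a != t ^+ b.

Let q0 : q != 0 := generic_q_neq0 gen.
Let t0 : t != 0 := generic_t_neq0 gen.

Lemma generic_shift_div s : generic_shift s -> generic_shift (s / t).
Proof.
move=> [s0 h]; split=> [|a b]; first by rewrite mulf_neq0 ?invr_neq0.
apply/eqP => E; case/eqP: (h a (b + 2)%N).
by rewrite exprD -E expr_div_n; field.
Qed.

Lemma gbracket_diff_neq0 s m k i : generic_shift s -> (m != k) || (i != 0%N) ->
  gbracket s m 0 - gbracket s k i != 0.
Proof.
move=> [s0 hs] hk; rewrite !gbracketE.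
set c := s * q / t ^+ 2.
have c0 : c != 0 by rewrite /c !mulf_neq0 ?invr_neq0 ?expf_neq0.
set a := pnt q t m 0; set b := pnt q t k i.
have a0 : a != 0 by apply: pnt_neq0 gen _ _.
have b0 : b != 0 by apply: pnt_neq0 gen _ _.
have ab : a - b != 0 by apply: (pnt_sub_neq0 gen); rewrite [0%N == i]eq_sym.
have -> : c * a + (c * a)^-1 - (c * b + (c * b)^-1) =
   (a - b) * (c ^+ 2 * a * b - 1) / (c * a * b).
  by field; rewrite c0 a0 b0.
suff cab : c ^+ 2 * a * b - 1 != 0.
  by apply: (mulf_neq0 (mulf_neq0 ab cab));
    rewrite invr_eq0 (mulf_neq0 (mulf_neq0 c0 a0) b0).
rewrite subr_eq0; apply/eqP => E; case/eqP: (hs (m + k + 2)%N (i + 4)%N).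
have ti : t ^+ i != 0 by rewrite expf_neq0.
rewrite -[RHS]mul1r -E /c /a /b /pnt expr0 !exprD; field.
by rewrite ti t0 oner_neq0.
Qed.

(** With nu_j = la_{j+1} each numerator equals its denominator. *)
Lemma psig_ftail N (la : nat -> nat) : (forall i, (la i.+1 <= la i)%N) -> psig q t N la (ftail la) = 1.
Proof.
move=> lap; rewrite /psig big1_seq // => i _; rewrite big1_seq // => j.
rewrite mem_index_iota => /andP[_ /andP[ij _]]; rewrite divff // gprod_neq0 //.
move=> k /andP[k1 _]; case: eqVneq => //= kj; apply/negP => /eqP E.
by move: k1; rewrite /ftail E; move: kj; rewrite /ftail => <-; rewrite ltnn.
Qed.

(** By [interp_vanish] only nu = (la_1, la_2, ...) contributes, at every step; its weight is a
    product of differences of distinct brackets. *)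
Lemma interp_diag_neq0 N s ms (la : 'X_{1..N.+1}) : generic_shift s -> sorted geq ms ->
  (forall i, rowlen la i = nth 0%N ms i) -> interp s (nodes s ms) la != 0.
Proof.
elim: ms s la => [|m ms IH] s la /= hs ms_sorted laE.
  have -> : la = 0%MM by apply/mnmP => i; rewrite -row_ord laE nth_nil mnm0E.
  by rewrite eqxx oner_eq0.
have lap i : (rowlen la i.+1 <= rowlen la i)%N.
  rewrite !laE; have [im|im] := ltnP i.+1 (size (m :: ms)); last by rewrite nth_default.
  by move/(pathP 0%N): ms_sorted => /(_ i im).
have I1 : interl la (mtail la).
  by apply/interlP => i; rewrite row_mtail /ftail leqnn lap.
rewrite /transfer (bigD1_seq (mtail la)) ?mem_strips ?strips_uniq //= big_seq_cond big1 ?addr0.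
  rewrite /weight (eq_psig q t _ (fun=> erefl) (row_mtail la)) psig_ftail // mul1r.
  rewrite mulf_neq0 //; last first.
    apply: IH (generic_shift_div hs) (path_sorted ms_sorted) _ => i.
    by rewrite row_mtail /ftail laE.
  rewrite /Xstrip prodf_seq_neq0; apply/allP => i _ /=.
  rewrite prodf_seq_neq0; apply/allP => k;
    rewrite mem_index_iota /= row_mtail => /andP[_ k2].
  apply: gbracket_diff_neq0 => //; case: (posnP i) k2 => [->|i0 _]; last by rewrite orbT.
  by rewrite laE /= => km; rewrite gtn_eqF.
move=> nu; rewrite mem_strips => /andP[/interlP hn nu_ne].
have [/eqP->|F0] := boolP (interp (s / t) (nodes (s / t) ms) nu == 0);
  first by rewrite mulr0.
have := interp_vanish (path_sorted ms_sorted) F0 => h.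
case/eqP: nu_ne; apply: row_inj => i; rewrite row_mtail /ftail.
by have := hn i; have := h i; have := laE i.+1 => /=; lia.
Qed.

End InterpolationFunction.

(** * Reverse tableaux and chains of partitions *)

Section Chains.
Variables (K : fieldType) (q t : K) (N : nat).
Implicit Types (la nu : 'X_{1..N.+1}) (s : K) (xs : seq K) (c : seq 'X_{1..N.+1}).

(** A chain lists the k diagrams after [la], without [la] itself, and ends at the empty diagram. *)
Fixpoint chains k la : seq (seq 'X_{1..N.+1}) :=
  if k is k'.+1 then [seq nu :: c | nu <- strips la, c <- chains k' nu]
  else if la == 0%MM then [:: [::]] else [::].

Fixpoint chain_weight s xs la c : K :=
  match xs, c with
  | x :: xs', nu :: c' => weight q t s x la nu * chain_weight (s / t) xs' nu c'
  | _, _ => 1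
  end.

Lemma interp_chains s xs la :
  interp q t s xs la = \sum_(c <- chains (size xs) la) chain_weight s xs la c.
Proof.
elim: xs s la => [|x xs IH] s la /=.
  by case: eqP => _; rewrite ?big_seq1 ?big_nil.
rewrite big_allpairs_dep /transfer; apply: eq_bigr => nu _.
by rewrite IH mulr_sumr.
Qed.

Lemma mem_chains k la c :
  (c \in chains k la) = [&& size c == k, path (@interl N) la c & last la c == 0%MM].
Proof.
elim: k la c => [|k IH] la c /=.
  case: c => [|nu c] /=; first by case: eqP.
  by case: eqP.
case: c => [|nu c] /=; first by apply/allpairsPdep => -[x [y []]].
rewrite eqSS -andbA; apply/allpairsPdep/and4P => [[x [y [+ + [-> ->]]]]|[h1 h2 h3 h4]].
  by rewrite mem_strips IH => -> /and3P[].
by exists nu, c; rewrite mem_strips IH h1 h3 h4 h2.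
Qed.

Lemma chains_uniq k la : uniq (chains k la).
Proof.
elim: k la => [|k IH] la /=; first by case: eqP.
apply: allpairs_uniq_dep; first exact: strips_uniq.
  by move=> nu _; apply: IH.
by move=> [a1 b1] [a2 b2] /= _ _ [-> ->].
Qed.

Lemma chain_weightE s xs (ch : nat -> 'X_{1..N.+1}) :
  chain_weight s xs (ch 0%N) (mkseq (fun k => ch k.+1) (size xs)) =
  \prod_(0 <= k < size xs) weight q t (s / t ^+ k) (nth 0 xs k) (ch k) (ch k.+1).
Proof.
elim: xs s ch => [|x xs IH] s ch /=; first by rewrite big_geq.
rewrite big_ltn // expr0 divr1 big_add1 /=; congr (_ * _).
rewrite (iotaDl 1 0) -map_comp (IH (s / t) (fun k => ch k.+1)).
apply: eq_bigr => k _; congr (weight _ _ _ _ _ _).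
by rewrite exprS invfM mulrA.
Qed.

End Chains.

(** Converts lengths defined as cardinals, as in [level] and [plength], into inequalities. *)
Lemma downset_card m (P : pred 'I_m) :
  (forall j j' : 'I_m, (j <= j')%N -> P j' -> P j) -> forall j : 'I_m, (j < #|P|)%N = P j.
Proof.
move=> down j.
have cardlt k : (k <= m)%N -> #|[pred i : 'I_m | (i < k)%N]| = k.
  by move=> km; rewrite -sum1_card (big_ord_narrow km) /= sum1_card card_ord.
apply/idP/idP => [|Pj].
  apply: contraTT => nPj; rewrite -leqNgt -[X in (_ <= X)%N](cardlt j (ltnW (ltn_ord j))).
  apply: subset_leq_card; apply/subsetP => i; rewrite !inE => Pi.
  by rewrite ltnNge; apply: contra nPj => /down; apply.
rewrite -[X in (X <= _)%N](cardlt j.+1 (ltn_ord j)).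
apply: subset_leq_card; apply/subsetP => i; rewrite inE ltnS => ij.
exact: down ij Pj.
Qed.

Section Tableaux.
Variables (N : nat) (mu : 'X_{1..N.+1}).
Hypothesis mu_part : is_partition mu.
Implicit Types (f : {ffun square mu -> 'I_N.+1}) (i : 'I_N.+1).

Definition cell i (j : 'I_(mu i)) : square mu := existT (fun i => 'I_(mu i)) i j.

Lemma tableau_row f i (j j' : 'I_(mu i)) : reverse_tableau f -> (j <= j')%N ->
  (f (cell j') <= f (cell j))%N.
Proof.
move=> /forallP /(_ (cell j)) /forallP /(_ (cell j')) /andP[/implyP h _] jj'.
by apply: h; rewrite /sqrow /sqcol /= eqxx ltnS.
Qed.

Lemma tableau_col f i i' (j : 'I_(mu i)) (j' : 'I_(mu i')) : reverse_tableau f ->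
  j = j' :> nat -> (i < i')%N -> (f (cell j') < f (cell j))%N.
Proof.
move=> /forallP /(_ (cell j)) /forallP /(_ (cell j')) /andP[_ /implyP h] jj' ii'.
by apply: h; rewrite /sqrow /sqcol /= jj' eqxx.
Qed.

Lemma levelE f k i : level f k i = #|[pred j : 'I_(mu i) | (k <= f (cell j))%N]|.
Proof.
rewrite mnmE -!sum1_card.
transitivity (\sum_(i' : 'I_N.+1 | i' == i) \sum_(j : 'I_(mu i') | k <= f (cell j)) 1)%N.
  by rewrite sig_big_dep; apply: eq_bigl => -[i' j].
by rewrite big_pred1_eq.
Qed.

Lemma levelP f k i (j : 'I_(mu i)) : reverse_tableau f ->
  (j < level f k i)%N = (k <= f (cell j))%N.
Proof.
move=> rt; rewrite levelE (@downset_card _ (fun j => k <= f (cell j))%N) //.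
by move=> j1 j2 j12 h; apply: leq_trans h (tableau_row rt j12).
Qed.

Lemma level_le f k i : (level f k i <= mu i)%N.
Proof. by rewrite levelE (leq_trans (max_card _)) // card_ord. Qed.

Lemma level0 f : level f 0 = mu.
Proof. by apply/mnmP => i; rewrite levelE (eq_card (B := predT)) ?card_ord. Qed.

Lemma level_full f : level f N.+1 = 0%MM.
Proof.
apply/mnmP => i; rewrite levelE mnm0E eq_card0 // => j; rewrite inE.
by apply/negbTE; rewrite -ltnNge.
Qed.

(** Columns decrease strictly: a square with [k <= f] lies directly below one with [k < f]. *)
Lemma interl_level f k : reverse_tableau f -> interl (level f k) (level f k.+1).
Proof.
move=> rt; apply/forallP => i; apply/andP; split; last first.
  rewrite !levelE; apply: subset_leq_card; apply/subsetP => j; rewrite !inE.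
  exact: ltnW.
have [iN|iN] := ltnP i.+1 N.+1; last by rewrite row_over.
rewrite -[i.+1]/(val (Ordinal iN)) row_ord leqNgt; apply/negP => h.
have h1 : (level f k.+1 i < mu (Ordinal iN))%N by apply: leq_trans h (level_le _ _ _).
have h2 : (level f k.+1 i < mu i)%N by apply: leq_trans h1 (mu_part _).
have := h; rewrite -[X in (X < _)%N]/(val (Ordinal h1)) levelP // => h3.
have h4 := @tableau_col f i (Ordinal iN) (Ordinal h2) (Ordinal h1) rt erefl (ltnSn _).
by have := leq_ltn_trans h3 h4; rewrite -levelP //= ltnn.
Qed.

Definition tableau_chain f := mkseq (fun k => level f k.+1) N.+1.

Lemma tableau_chain_inj f g : reverse_tableau f -> reverse_tableau g ->
  tableau_chain f = tableau_chain g -> f = g.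
Proof.
move=> rtf rtg E; apply/ffunP => -[i j]; rewrite -/(cell j).
have lev k : (k < N.+1)%N -> level f k.+1 = level g k.+1.
  by move=> kN; move/(congr1 (fun c => nth 0%MM c k)): E; rewrite !nth_mkseq.
have le k : (k <= N)%N -> (k <= f (cell j))%N = (k <= g (cell j))%N.
  case: k => // k kN; rewrite -!levelP // lev //; exact: leqW.
apply/val_inj/eqP; rewrite eqn_leq /=.
by rewrite -le ?leqnn ?le ?leqnn // -ltnS.
Qed.

(** A square receives the last index k for which [ch k] still contains it; k = 0 always qualifies
    once [ch 0] is mu. *)
Definition chain_tableau (ch : nat -> 'X_{1..N.+1}) : {ffun square mu -> 'I_N.+1} :=
  [ffun a : square mu =>
    [arg max_(k > (ord0 : 'I_N.+1) | ((tagged a : 'I_(mu (tag a))) < ch k (tag a))%N) (k : nat)]].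

Section ChainTableau.
Variable ch : nat -> 'X_{1..N.+1}.
Hypotheses (ch0 : ch 0%N = mu) (chN : ch N.+1 = 0%MM).
Hypothesis ch_interl : forall k, (k < N.+1)%N -> interl (ch k) (ch k.+1).

Lemma chain_antitone k k' i : (k <= k' <= N.+1)%N -> (ch k' i <= ch k i)%N.
Proof.
case/andP => kk' k'N; elim: k' kk' k'N => [|k' IH]; first by rewrite leqn0 => /eqP ->.
rewrite leq_eqVlt => /orP[/eqP -> //|kk'] k'N.
apply: leq_trans (IH kk' (ltnW k'N)).
by have /forallP /(_ i) /andP[] := ch_interl k'N.
Qed.

Lemma chain_tableauP k i (j : 'I_(mu i)) : (k <= N.+1)%N ->
  (k <= chain_tableau ch (cell j))%N = (j < ch k i)%N.
Proof.
move=> kN; rewrite ffunE /=; case: arg_maxnP => [|c jc cmax]; first by rewrite ch0.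
apply/idP/idP => [kc|jk].
  by apply: leq_trans jc _; apply: chain_antitone; rewrite kc ltnW.
move: kN; rewrite leq_eqVlt => /orP[/eqP kE|kN].
  by move: jk; rewrite kE chN mnm0E.
exact: (cmax (Ordinal kN)).
Qed.

Lemma chain_tableau_rt : reverse_tableau (chain_tableau ch).
Proof.
apply/forallP => -[i j]; apply/forallP => -[i' j'];
  rewrite /sqrow /sqcol /= -/(cell j) -/(cell j').
apply/andP; split; apply/implyP => /andP[].
  rewrite eqSS => /eqP /val_inj ii'; rewrite ltnS; case: i' / ii' j' => j' jj'.
  have := leqnn (chain_tableau ch (cell j')).
  rewrite {1}chain_tableauP ?(ltnW (ltn_ord _)) // chain_tableauP ?(ltnW (ltn_ord _)) //.
  exact: leq_ltn_trans.
rewrite eqSS ltnS => /eqP jj' ii'.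
(* The lower square lies in [ch c], so by interlacing the upper one lies in [ch c.+1] and has a
   larger value. *)
pose c : nat := chain_tableau ch (cell j').
have cN : (c < N.+1)%N := ltn_ord _.
have : (c <= chain_tableau ch (cell j'))%N by [].
rewrite -/c -[(chain_tableau ch (cell j') < _)%N]/(c < _)%N !chain_tableauP ?(ltnW cN) // -jj' => h.
apply: leq_trans h _; apply: (@leq_trans (rowlen (ch c) i.+1)).
  rewrite -row_ord; have /interlP I := ch_interl cN.
  have lap k : (rowlen (ch c) k.+1 <= rowlen (ch c) k)%N.
    by have := I k; lia.
  move: ii'; elim: (nat_of_ord i') => // k IH; rewrite ltnS leq_eqVlt => /orP[/eqP->//|ik].
  exact: leq_trans (lap k) (IH ik).
by have /forallP /(_ i) /andP[] := ch_interl cN.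
Qed.

Lemma level_chain_tableau k : (k <= N.+1)%N -> level (chain_tableau ch) k = ch k.
Proof.
move=> kN; apply/mnmP => i.
have h1 := level_le (chain_tableau ch) k i.
have h2 : (ch k i <= mu i)%N by rewrite -ch0 chain_antitone.
have E j : (j < mu i)%N -> (j < level (chain_tableau ch) k i)%N = (j < ch k i)%N.
  move=> jm; rewrite -[j]/(val (Ordinal jm)) levelP ?chain_tableau_rt //.
  exact: chain_tableauP.
apply/eqP; rewrite eqn_leq; apply/andP; split; rewrite leqNgt; apply/negP => h.
  by have := E _ (leq_trans h h1); rewrite h ltnn.
by have := E _ (leq_trans h h2); rewrite h ltnn.
Qed.

End ChainTableau.

Lemma perm_tableaux :
  perm_eq [seq tableau_chain f | f <- enum [pred f | reverse_tableau f]] (chains N.+1 mu).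
Proof.
apply: uniq_perm; last 1 first; try exact: chains_uniq.
- move=> c; rewrite mem_chains; apply/mapP/and3P => [[f]|[/eqP sc cp /eqP cl]].
    rewrite mem_enum inE => rt ->; rewrite size_mkseq; split=> //.
      apply/(pathP 0%MM) => k; rewrite size_mkseq => kN.
      rewrite nth_mkseq //; case: k kN => [|k] kN /=;
        first by rewrite -{1}(level0 f) interl_level.
      by rewrite (nth_mkseq _ _ (ltnW kN)) interl_level.
    by rewrite -nth_last size_mkseq nth_mkseq // level_full.
  pose ch k := nth 0%MM (mu :: c) k.
  have ch_interl k : (k < N.+1)%N -> interl (ch k) (ch k.+1).
    by move=> kN; apply: (pathP 0%MM cp); rewrite sc.
  have chN : ch N.+1 = 0%MM by move: cl; rewrite (last_nth 0%MM) sc.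
  exists (chain_tableau ch); first by rewrite mem_enum inE chain_tableau_rt.
  apply: (@eq_from_nth _ 0%MM); first by rewrite size_mkseq.
  by move=> k; rewrite sc => kN; rewrite nth_mkseq // level_chain_tableau.
- rewrite map_inj_in_uniq ?enum_uniq // => f g; rewrite !mem_enum !inE.
  exact: tableau_chain_inj.
Qed.

(** Squares are grouped by value k and row i; they fill the columns between the lengths of row i in
    levels k+1 and k. *)
Lemma prod_tableau (R : comNzRingType) (G : nat -> nat -> nat -> R) f : reverse_tableau f ->
  \prod_(a : square mu) G (f a) (tag a) (tagged a) =
  \prod_(0 <= k < N.+1) \prod_(0 <= i < N.+1)
     \prod_(rowlen (level f k.+1) i <= j < rowlen (level f k) i) G k i j.
Proof.
move=> rt.
transitivity (\prod_(i < N.+1) \prod_(j < mu i) G (f (cell j)) i j).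
  by rewrite sig_big_dep; apply: eq_bigr => -[i j].
rewrite big_mkord; under [RHS]eq_bigr => k _ do rewrite big_mkord.
rewrite exchange_big; apply: eq_bigr => i _ /=.
rewrite (partition_big (fun j => f (cell j)) xpredT) //=.
apply: eq_bigr => k _; rewrite !row_ord.
rewrite (big_nat_widen _ _ (mu i)) ?level_le // (big_nat_widenl _ 0%N) // big_mkord.
apply: eq_big => [j|j /eqP -> //].
by rewrite /= (@levelP f k i j rt) [X in _ && X]leqNgt (@levelP f k.+1 i j rt) -ltnNge ltnS -eqn_leq eq_sym.
Qed.

End Tableaux.

(** * Genericity of q, t, s and comparison of the two forms of psi *)

Lemma q_t_generic a b c d : q ^+ a * t ^+ b = q ^+ c * t ^+ d -> a = c /\ b = d.
Proof.
rewrite /q /t -!rmorphXn -!rmorphM /= => /eqP; rewrite tofrac_eq !mpolyXn -!mpolyXD.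
set m1 := (_ + _)%MM; set m2 := (_ + _)%MM => /eqP /(congr1 (mcoeff m1)).
rewrite !mcoeffX eqxx; case: (eqVneq m2 m1) => [E _|_ /eqP]; last by rewrite oner_eq0.
have := congr1 (fun m : 'X_{1..3} => m (inord 0)) E;
  have := congr1 (fun m : 'X_{1..3} => m (inord 1)) E.
rewrite /m1 /m2 !mnmDE !mulmnE !mnm1E -!val_eqE /= !inordK //=; lia.
Qed.

Lemma s_generic : generic_shift q t s.
Proof.
split; first by rewrite /s tofrac_eq0 -msupp_eq0 msuppX.
move=> a b; rewrite /q /t /s -!rmorphXn -!rmorphM /= tofrac_eq !mpolyXn -!mpolyXD.
set m1 := (_ + _)%MM; set m2 := (_ *+ b)%MM.
apply/eqP => /(congr1 (mcoeff m1)).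
rewrite !mcoeffX eqxx; case: (eqVneq m2 m1) => [E _|_ /eqP]; last by rewrite oner_eq0.
(* The exponent of s is 2 on one side and 0 on the other. *)
have := congr1 (fun m : 'X_{1..3} => m (inord 2)) E.
by rewrite /m1 /m2 !mnmDE !mulmnE !mnm1E -!val_eqE /= !inordK //=; lia.
Qed.

Section PsiDefs.
Variables (K : fieldType) (q t : K) (N : nat).
Hypothesis gen : forall a b c d, q ^+ a * t ^+ b = q ^+ c * t ^+ d -> a = c /\ b = d.
Implicit Types la nu mu : 'X_{1..N.+1}.

Lemma plength_lt nu (j : 'I_N.+1) : (forall i, (rowlen nu i.+1 <= rowlen nu i)%N) ->
  (j < plength nu)%N = (0 < nu j)%N.
Proof.
move=> nup; rewrite /plength (@downset_card _ (fun i => 0 < nu i)%N) // => i i' ii'.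
rewrite -!row_ord => h; apply: leq_trans h _.
move: ii'; elim: (nat_of_ord i') => [|k IH]; first by rewrite leqn0 => /eqP ->.
by rewrite leq_eqVlt => /orP[/eqP -> //|ik]; apply: leq_trans (nup k) (IH ik).
Qed.

(** The product is [psi] over a general field; rows shift from base 1 to base 0, and [g1] at (nu_j,
    j) is divided by [g1] at (la_{j+1}, j). *)
Lemma psi_prod_psig la nu : interl la nu -> rowlen nu N = 0%N ->
  \prod_(1 <= j < (plength nu).+1) \prod_(1 <= i < j.+1)
  \prod_(0 <= k < part la i - part nu i)
    (((1 - q ^+ (part nu i - part nu j + k) * t ^+ (j - i + 1))
      * (1 - q ^+ (part nu i - part la j.+1 + k + 1) * t ^+ (j - i)))
     / ((1 - q ^+ (part nu i - part nu j + k + 1) * t ^+ (j - i))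
      * (1 - q ^+ (part nu i - part la j.+1 + k) * t ^+ (j - i + 1))))
  = psig q t N (rowlen la) (rowlen nu).
Proof.
move=> /interlP I1 nuN.
have nup i : (rowlen nu i.+1 <= rowlen nu i)%N by have := I1 i; have := I1 i.+1; lia.
have pl_le : (plength nu <= N)%N.
  have := plength_lt ord_max nup; rewrite -row_ord /= nuN ltnn => /negbT;
    by rewrite -leqNgt.
have nu0 j : (plength nu <= j)%N -> rowlen nu j = 0%N.
  have [jN|jN] := ltnP j N.+1; last by rewrite row_over.
  by have := plength_lt (Ordinal jN) nup; rewrite -row_ord /= => + h; rewrite ltnNge h /=;
    lia.
pose D i j := gprod q t (rowlen nu i) (rowlen la i) i j (rowlen nu j)
              / gprod q t (rowlen nu i) (rowlen la i) i j (rowlen la j.+1).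
have q0 : q != 0 := generic_q_neq0 gen.
have t0 : t != 0 := generic_t_neq0 gen.
transitivity (\prod_(0 <= j < plength nu) \prod_(0 <= i < j.+1) D i j).
  rewrite big_add1 /=; apply: eq_bigr => j _; rewrite big_add1 /=.
  apply: eq_big_nat => i /andP[_ ij].
  rewrite /D /gprod -prodfV -big_split /= -{1}[rowlen nu i]add0n big_addn /part /=.
  rewrite -!/(rowlen _ _); apply: eq_big_nat => k /andP[_ kl].
  have ij' : (i <= j)%N by rewrite -ltnS.
  have E m : (m <= rowlen nu i)%N ->
      pnt q t (k + rowlen nu i) i / pnt q t m j = q ^+ (rowlen nu i - m + k) * t ^+ (j - i).
    move=> mi; rewrite /pnt.
    have -> : (k + rowlen nu i = (rowlen nu i - m + k) + m)%N by lia.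
    have -> : t ^+ j = t ^+ (j - i) * t ^+ i by rewrite -exprD subnK.
    rewrite exprD.
    have qm : q ^+ m != 0 by rewrite expf_neq0.
    have ti : t ^+ i != 0 by rewrite expf_neq0.
    have tj : t ^+ (j - i) != 0 by rewrite expf_neq0.
    by field; rewrite qm ti tj.
  have le1 : (rowlen nu j <= rowlen nu i)%N.
    move: ij'; elim: j {ij E} => [|j IH]; first by rewrite leqn0 => /eqP ->.
    by rewrite leq_eqVlt => /orP[/eqP -> //|ij]; apply: leq_trans (nup j) (IH ij).
  have le2 : (rowlen la j.+1 <= rowlen nu i)%N.
    by apply: leq_trans le1; have := I1 j; lia.
  have g1E m : (m <= rowlen nu i)%N -> g1 q t (pnt q t (k + rowlen nu i) i) (pnt q t m j) =
    (1 - q ^+ (rowlen nu i - m + k) * t ^+ (j - i + 1))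
    / (1 - q ^+ (rowlen nu i - m + k + 1) * t ^+ (j - i)).
    move=> mi; rewrite /g1 -[t * _ / _]mulrA -[q * _ / _]mulrA (E _ mi) !exprD !expr1.
    by congr ((1 - _) / (1 - _)); ring.
  rewrite (g1E _ le1) (g1E _ le2) subSS invfM.
  by rewrite [(_ / _)^-1]invf_div; ring.
rewrite /psig.
(* The columns from l(nu) to N-1 contribute 1, as nu_j = la_{j+1} = 0 there. *)
transitivity (\prod_(0 <= j < N) \prod_(0 <= i < j.+1) D i j).
  rewrite [RHS](big_cat_nat (leq0n _) pl_le) /= [X in _ = _ * X]big1_seq ?mulr1 //.
  move=> j; rewrite mem_index_iota => /andP[_ /andP[pj _]]; apply: big1_seq => i.
  rewrite mem_index_iota => /andP[_ /andP[_ ij]]; rewrite /D.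
  have -> : rowlen la j.+1 = 0%N by have := I1 j; rewrite (nu0 j pj); lia.
  by rewrite (nu0 j pj) divff // gprod_neq0.
under [RHS]eq_bigr => i _ do rewrite (big_nat_widenl _ 0%N) //.
rewrite (exchange_big_dep_nat xpredT) //=; apply: eq_big_nat => j /andP[_ jN].
by rewrite (big_nat_widen _ _ N.+1) // 1?ltnW //; apply: eq_bigl => i; rewrite ltnS.
Qed.

End PsiDefs.

Lemma psi_psig N (la nu : 'X_{1..N.+1}) : interl la nu -> rowlen nu N = 0%N ->
  psi la nu = psig q t N (rowlen la) (rowlen nu).
Proof. exact: (psi_prod_psig q_t_generic). Qed.

(** * The tableau sum as a polynomial *)

Section TableauPolynomial.
Variables (K : fieldType) (q t s : K) (N : nat) (mu : 'X_{1..N.+1}).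
Hypothesis mu_part : is_partition mu.
Implicit Types f : {ffun square mu -> 'I_N.+1}.

Definition tableau_coef f : K :=
  \prod_(k < N.+1) psig q t N (rowlen (level f k)) (rowlen (level f k.+1)).

Definition tableau_poly : {mpoly K[N.+1]} :=
  \sum_(f : {ffun square mu -> 'I_N.+1} | reverse_tableau f)
    tableau_coef f *: \prod_(a : square mu)
          ('X_(f a)
           - (s * q ^+ sqcol a / t ^+ ((f a).+1 + sqrow a))%:MP
           - (t ^+ ((f a).+1 + sqrow a) / (s * q ^+ sqcol a))%:MP).

(** Downward induction from the empty level N+1: each strip adds at most one row. *)
Lemma level_last f m i : reverse_tableau f -> (m <= N.+1)%N -> (m <= i)%N ->
  rowlen (level f (N.+1 - m)) i = 0%N.
Proof.
move=> rt; elim: m i => [|m IH] i mN mi.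
  rewrite subn0; have [h|h] := ltnP i N.+1; last by rewrite row_over.
  by rewrite -[i]/(val (Ordinal h)) row_ord level_full mnm0E.
case: i mi => // i mi; apply/eqP; rewrite -leqn0 -(IH i (ltnW mN) mi).
have /interlP /(_ i) /andP[h _] := interl_level mu_part (N.+1 - m.+1) rt.
by move: h; rewrite -subSn.
Qed.

Lemma psig_map (L : fieldType) (h : {rmorphism K -> L}) la nu :
  h (psig q t N la nu) = psig (h q) (h t) N la nu.
Proof.
have pntE k i : h (pnt q t k i) = pnt (h q) (h t) k i by rewrite /pnt fmorph_div !rmorphXn.
have g1E z u : h (g1 q t z u) = g1 (h q) (h t) (h z) (h u).
  by rewrite /g1 !(fmorph_div, rmorphB, rmorphM) rmorph1.
have gE a b i j m : h (gprod q t a b i j m) = gprod (h q) (h t) a b i j m.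
  by rewrite rmorph_prod; apply: eq_bigr => k _; rewrite g1E !pntE.
rewrite rmorph_prod; apply: eq_bigr => i _; rewrite rmorph_prod; apply: eq_bigr => j _.
by rewrite fmorph_div !gE.
Qed.

(** A morphism h to a field covers both uses: the embedding into the fraction field, for symmetry,
    and evaluation at a point, for vanishing. *)
Lemma interp_tableau_poly (L : fieldType) (h : {rmorphism {mpoly K[N.+1]} -> L}) :
  h tableau_poly = interp (h q%:MP) (h t%:MP) (h s%:MP) [seq h 'X_i | i <- enum 'I_N.+1] mu.
Proof.
pose hC : {rmorphism K -> L} := h \o (@mpolyC N.+1 K).
have hCE c : h c%:MP = hC c by [].
set xs := [seq _ | _ <- _]; have szxs : size xs = N.+1 by rewrite size_map size_enum_ord.
rewrite interp_chains szxs -(perm_big _ (perm_tableaux mu_part)) /= big_map big_enum_cond /=.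
rewrite rmorph_sum; apply: eq_big => [f|f rt]; first by rewrite andbT.
rewrite -mul_mpolyC rmorphM hCE !hCE rmorph_prod rmorph_prod.
have := chain_weightE (hC q) (hC t) (hC s) xs (level f).
rewrite szxs level0 -/(tableau_chain f) => ->.
under [RHS]eq_bigr => k _ do rewrite /weight.
rewrite big_split /= big_mkord; congr (_ * _).
  by apply: eq_bigr => k _; exact: (psig_map hC).
pose G k i j := nth 0 xs k - gbracket (hC q) (hC t) (hC s / hC t ^+ k) j i.
transitivity (\prod_(a : square mu) G (f a) (tag a) (tagged a)); last first.
  by rewrite prod_tableau.
apply: eq_bigr => -[i j] _; rewrite /sqcol /sqrow /= -/(cell j) /G /gbracket.
rewrite !rmorphB !hCE (nth_map ord0) ?size_enum_ord // nth_ord_enum.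
rewrite !rmorphM !fmorphV !rmorphM !rmorphXn opprD addrA.
set k := f (cell j).
(* The shift s/t^k accounts for the entry of the tableau in the exponent of t. *)
have -> : hC s / hC t ^+ k * hC q ^+ j.+1 / hC t ^+ i.+2 = hC s * hC q ^+ j.+1 / hC t ^+ (k.+1 + i.+1).
  have -> : (k.+1 + i.+1 = k + i.+2)%N by lia.
  by move: (hC s) (hC q) (hC t) => S Q T; rewrite (exprD _ k i.+2) [(T ^+ k * _)^-1]invfM;
    move: (T ^- k) (T ^- i.+2) (Q ^+ j.+1) => A B C; ring.
by rewrite invf_div.
Qed.

End TableauPolynomial.

Import Order.TTheory.

(** * Leading monomial and uniqueness *)

Section LeadingMonomial.
Variables (K : fieldType) (q t s : K) (N : nat) (mu : 'X_{1..N.+1}).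
Hypothesis gen : forall a b c d, q ^+ a * t ^+ b = q ^+ c * t ^+ d -> a = c /\ b = d.
Hypothesis mu_part : is_partition mu.
Implicit Types f : {ffun square mu -> 'I_N.+1}.

(** The exponent of the leading monomial of the term of f. *)
Definition content f : 'X_{1..N.+1} := (\sum_(a : square mu) U_(f a))%MM.

Lemma mdeg_level f k : mdeg (level f k) = (\sum_(a : square mu) (k <= f a)%N)%N.
Proof.
rewrite mdegE (partition_big (fun a : square mu => tag a) xpredT) //=.
apply: eq_bigr => i _; rewrite mnmE -sum1_card big_mkcondr /=.
by apply: eq_bigr => a _; case: leqP.
Qed.

Lemma content_level f (k : 'I_N.+1) :
  (content f k + mdeg (level f k.+1) = mdeg (level f k))%N.
Proof.
rewrite /content mnm_sumE !mdeg_level -big_split /=; apply: eq_bigr => a _.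
by rewrite mnm1E -val_eqE /= eq_sym [in RHS]leq_eqVlt; case: ltngtP.
Qed.

Lemma content_level_sum f k : (k <= N.+1)%N ->
  (\sum_(0 <= j < k) rowlen (content f) j + mdeg (level f k) = mdeg mu)%N.
Proof.
elim: k => [|k IH] kN; first by rewrite big_geq // level0.
by rewrite -(IH (ltnW kN)) big_nat_recr //= -(content_level f (Ordinal kN)) -row_ord addnA.
Qed.

Lemma mdeg_content f : mdeg (content f) = mdeg mu.
Proof.
rewrite -(content_level_sum f (leqnn _)) level_full mdeg0 addn0 mdegE big_mkord.
by apply: eq_bigr => i _; rewrite row_ord.
Qed.

Lemma level_ge f k i : reverse_tableau f -> (rowlen mu (i + k) <= rowlen (level f k) i)%N.
Proof.
move=> rt; elim: k i => [|k IH] i; first by rewrite addn0 level0.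
have /interlP /(_ i) /andP[h _] := interl_level mu_part k rt.
by apply: leq_trans h; rewrite addnS -addSn.
Qed.

Lemma mdeg_shift k : (k <= N.+1)%N ->
  (\sum_(0 <= j < k) rowlen mu j + \sum_(0 <= i < N.+1) rowlen mu (i + k) = mdeg mu)%N.
Proof.
move=> kN; rewrite mdeg_row [RHS](big_cat_nat (leq0n k) kN) /=; congr (_ + _)%N.
rewrite -[in RHS](add0n k) big_addn [LHS](big_cat_nat (leq0n (N.+1 - k)) (leq_subr _ _)) /=.
rewrite [X in (_ + X)%N]big1_seq ?addn0 // => i.
by rewrite mem_index_iota => /andP[_ /andP[h _]]; rewrite row_over //; lia.
Qed.

(** Dominance: the first k parts of the content sum to |mu| minus the size of level k, and level k
    contains mu with its first k rows deleted. *)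
Lemma content_le f : reverse_tableau f -> (content f <= mu)%O.
Proof.
move=> rt; rewrite leNgt; apply/negP => /ltmcP;
  rewrite mdeg_content => /(_ erefl) [i eqi lti].
have h1 := content_level_sum f (ltn_ord i); have h2 := mdeg_shift (ltn_ord i).
have h3 : (\sum_(0 <= j < N.+1) rowlen mu (j + i.+1) <= mdeg (level f i.+1))%N.
  by rewrite mdeg_row; apply: leq_sum => j _; apply: level_ge.
set S := (\sum_(0 <= j < N.+1) _)%N in h2 h3 *.
move: h1 h2; rewrite !big_nat_recr //= (@eq_big_nat _ _ _ _ _ _ (rowlen mu)); last first.
  move=> j /andP[_ ji]; have jN : (j < N.+1)%N by apply: ltn_trans ji _.
  by rewrite -[j]/(val (Ordinal jN)) !row_ord eqi.
by rewrite !row_ord; lia.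
Qed.

Lemma level_content f k i : reverse_tableau f -> content f = mu -> (k <= N.+1)%N ->
  rowlen (level f k) i = rowlen mu (i + k).
Proof.
move=> rt E kN; have [iN|iN] := ltnP i N.+1;
  last by rewrite !row_over // (leq_trans iN) ?leq_addr.
have h1 := content_level_sum f kN; rewrite E -(mdeg_shift kN) in h1.
move/addnI: h1; rewrite mdeg_row => /esym/eqP h1.
apply/eqP; rewrite eqn_leq level_ge // andbT leqNgt; apply/negP => lt_i.
move: h1; rewrite !big_mkord (bigD1 (Ordinal iN)) //= [X in _ == X](bigD1 (Ordinal iN)) //=.
have : (\sum_(j < N.+1 | j != Ordinal iN) rowlen mu (j + k) <= \sum_(j < N.+1 | j != Ordinal iN) rowlen (level f k) j)%N.
  by apply: leq_sum => j _; apply: level_ge.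
by move=> h /eqP E2; have := leq_add lt_i h; rewrite addSn E2 ltnn.
Qed.

Definition mdrop k : 'X_{1..N.+1} := [multinom rowlen mu (i + k) | i < N.+1].

Lemma row_mdrop k : rowlen (mdrop k) =1 fun i => rowlen mu (i + k).
Proof.
move=> i; rewrite (row_multinom _ (fun i => rowlen mu (i + k))); case: ltnP => // h.
by rewrite row_over // (leq_trans h) ?leq_addr.
Qed.

Lemma mu_row_le i : (rowlen mu i.+1 <= rowlen mu i)%N.
Proof.
have [h|h] := ltnP i.+1 N.+1; last by rewrite row_over.
rewrite -[i.+1]/(val (Ordinal h)) -[i in X in (_ <= X)%N]/(val (Ordinal (ltnW h))) !row_ord.
by apply: mu_part; rewrite /= leqnSn.
Qed.

Lemma mdrop_interl k : interl (mdrop k) (mdrop k.+1).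
Proof.
by apply/interlP => i; rewrite !row_mdrop addnS -addSn leqnn mu_row_le.
Qed.

Lemma mdrop0 : mdrop 0 = mu.
Proof. by apply: row_inj => i; rewrite row_mdrop addn0. Qed.

Lemma mdrop_full : mdrop N.+1 = 0%MM.
Proof. by apply/mnmP => i; rewrite -row_ord row_mdrop row_over ?leq_addl // mnm0E. Qed.

(** Each square carries its height in its column, counted from the bottom; this is the only tableau
    of content mu. *)
Definition lead_tableau := chain_tableau mu mdrop.

Lemma lead_tableau_rt : reverse_tableau lead_tableau.
Proof.
apply: chain_tableau_rt; [exact: mdrop0|exact: mdrop_full|].
by move=> k _; apply: mdrop_interl.
Qed.

Lemma level_lead k : (k <= N.+1)%N -> level lead_tableau k = mdrop k.
Proof.
apply: level_chain_tableau; [exact: mdrop0|exact: mdrop_full|].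
by move=> j _; apply: mdrop_interl.
Qed.

Lemma content_lead : content lead_tableau = mu.
Proof.
apply/mnmP => k; have := content_level lead_tableau k.
rewrite !level_lead ?(ltnW (ltn_ord k)) //; have := ltn_ord k => kN.
have h1 := mdeg_shift (ltnW kN); have h2 := mdeg_shift kN.
have E j : mdeg (mdrop j) = (\sum_(0 <= i < N.+1) rowlen mu (i + j))%N.
  by rewrite mdeg_row; apply: eq_bigr => i _; rewrite row_mdrop.
by rewrite !E; move: h2; rewrite big_nat_recr //= row_ord; lia.
Qed.

Lemma content_eq f : reverse_tableau f -> content f = mu -> f = lead_tableau.
Proof.
move=> rt E; apply: tableau_chain_inj => //; first exact: lead_tableau_rt.
apply: (@eq_from_nth _ 0%MM); rewrite !size_mkseq // => k kN; rewrite !nth_mkseq //.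
by rewrite level_lead //; apply: row_inj => i; rewrite level_content // row_mdrop.
Qed.

Definition tableau_prod f : {mpoly K[N.+1]} := \prod_(a : square mu)
  ('X_(f a) - (s * q ^+ sqcol a / t ^+ ((f a).+1 + sqrow a))%:MP
           - (t ^+ ((f a).+1 + sqrow a) / (s * q ^+ sqcol a))%:MP).

Lemma mleadXsubC (i : 'I_N.+1) (c : K) :
  mlead ('X_i - c%:MP : {mpoly K[N.+1]}) = U_(i)%MM /\
  ('X_i - c%:MP : {mpoly K[N.+1]})@_(U_(i)) = 1.
Proof.
split; last first.
  by rewrite mcoeffB mcoeffX eqxx mcoeffC mnm1_eq0 mulr0 subr0.
rewrite mleadDl mleadXm // mleadN mleadC.
by apply: lt_mdeg_ltmc; rewrite mdeg0 mdeg1.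
Qed.

Lemma tableau_prod_lead f :
  (mlead (tableau_prod f) <= content f)%O /\ (tableau_prod f)@_(content f) = 1.
Proof.
have E : tableau_prod f = \prod_(a : square mu) ('X_(f a) -
  (s * q ^+ sqcol a / t ^+ ((f a).+1 + sqrow a) + t ^+ ((f a).+1 + sqrow a) / (s * q ^+ sqcol a))%:MP).
  by apply: eq_bigr => a _; rewrite mpolyCD opprD addrA.
have C : content f = (\sum_(a : square mu) mlead ('X_(f a) -
  (s * q ^+ sqcol a / t ^+ ((f a).+1 + sqrow a) + t ^+ ((f a).+1 + sqrow a) / (s * q ^+ sqcol a))%:MP
   : {mpoly K[N.+1]}))%MM.
  by apply: eq_bigr => a _; rewrite (mleadXsubC _ _).1.
rewrite E C; split; first exact: mlead_prod_le.
by rewrite mleadc_prod big1 // => a _; rewrite (mleadXsubC _ _).1 (mleadXsubC _ _).2.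
Qed.

Lemma tableau_poly_le m : (tableau_poly q t s mu)@_m != 0 -> (m <= mu)%O.
Proof.
apply: contraNT; rewrite -ltNge => h; rewrite /tableau_poly raddf_sum /=; apply/eqP.
rewrite big1 // => f rt; rewrite mcoeffZ -/(tableau_prod f) mcoeff_gt_mlead ?mulr0 //.
exact: le_lt_trans (tableau_prod_lead f).1 (le_lt_trans (content_le rt) h).
Qed.

(** Every strip of [lead_tableau] comes from deleting a first row, so [psig_ftail] applies. *)
Lemma tableau_coef_lead : tableau_coef q t lead_tableau = 1.
Proof.
rewrite /tableau_coef big1 // => k _; rewrite !level_lead ?(ltnW (ltn_ord k)) //.
rewrite (@eq_psig _ q t N _ (rowlen (mdrop k)) _ (ftail (rowlen (mdrop k)))) //.
  by apply: (psig_ftail gen) => i; rewrite !row_mdrop addSn mu_row_le.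
by move=> i; rewrite /ftail !row_mdrop addnS -addSn.
Qed.

Lemma tableau_poly_coef : (tableau_poly q t s mu)@_mu = 1.
Proof.
rewrite /tableau_poly raddf_sum /= (bigD1 lead_tableau) ?lead_tableau_rt //= [X in _ + X]big1 ?addr0.
  have h := (tableau_prod_lead lead_tableau).2; rewrite content_lead in h.
  by rewrite mcoeffZ tableau_coef_lead mul1r.
move=> f /andP[rt ne]; rewrite mcoeffZ -/(tableau_prod f) mcoeff_gt_mlead ?mulr0 //.
apply: le_lt_trans (tableau_prod_lead f).1 _; rewrite lt_neqAle content_le // andbT.
by apply: contraNneq ne => /(content_eq rt) ->.
Qed.

Lemma tableau_poly_neq0 : tableau_poly q t s mu != 0.
Proof.
by apply/eqP => E; have := tableau_poly_coef; rewrite E mcoeff0 => /esym/eqP;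
  rewrite oner_eq0.
Qed.

Lemma tableau_poly_size : (msize (tableau_poly q t s mu) <= (mdeg mu).+1)%N.
Proof.
rewrite -mlead_deg ?tableau_poly_neq0 // ltnS lemc_mdeg // tableau_poly_le //.
by rewrite mleadc_eq0 tableau_poly_neq0.
Qed.

End LeadingMonomial.

(** * Symmetry, triangularity and uniqueness *)

Section Interpolation.
Variables (K : fieldType) (q t s : K) (N : nat).
Hypothesis gen : forall a b c d, q ^+ a * t ^+ b = q ^+ c * t ^+ d -> a = c /\ b = d.
Hypothesis s_gen : generic_shift q t s.
Implicit Types (mu la ka : 'X_{1..N.+1}) (p : {mpoly K[N.+1]}).
Local Notation tpoly mu := (tableau_poly q t s mu).

(* Symmetry is tested after embedding into the fraction field of the polynomial
   ring, where the variables are field elements and [interp_perm] applies. *)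
Lemma tableau_poly_sym mu : is_partition mu -> tpoly mu \is symmetric.
Proof.
move=> mu_part; apply/issymP => sg.
pose L : fieldType := {fraction {mpoly K[N.+1]}}.
pose h : {rmorphism {mpoly K[N.+1]} -> L} := @FracField.tofrac _.
(* [h] and [h'] send the variables to the same elements in different order, and agree on
   constants. *)
pose h' : {rmorphism {mpoly K[N.+1]} -> L} := h \o msym sg.
apply/eqP; rewrite -tofrac_eq; apply/eqP;
  rewrite -[LHS]/(h' (tpoly mu)) -[RHS]/(h (tpoly mu)).
rewrite !interp_tableau_poly //.
have h'C c : h' c%:MP = h c%:MP by rewrite /h' /= -[c%:MP]mulr1 mul_mpolyC msymZ msym1.
rewrite !h'C; apply: interp_perm.
- pose hC : {rmorphism K -> L} := h \o (@mpolyC N.+1 K).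
  move=> a b c d; rewrite -[h q%:MP]/(hC q) -[h t%:MP]/(hC t) -!rmorphXn -!rmorphM.
  by move/fmorph_inj/gen.
- by rewrite size_map size_enum_ord.
have -> : [seq h' 'X_i | i <- enum 'I_N.+1] = [seq h 'X_i | i <- map sg (enum 'I_N.+1)].
  rewrite -[RHS]map_comp; apply: eq_map => i /=; rewrite msymX; congr (FracField.tofrac _);
    congr mpolyX.
  apply/mnmP => j; rewrite mnmE !mnm1E; congr (nat_of_bool _).
  by rewrite -(inj_eq (@perm_inj _ sg)) permKV.
apply: perm_map; apply: uniq_perm; last 1 first; try exact: enum_uniq.
- move=> i; rewrite mem_enum; apply/mapP; exists (sg^-1 i)%g; first by rewrite mem_enum.
  by rewrite permKV.
- by rewrite map_inj_uniq ?enum_uniq //; apply: perm_inj.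
Qed.

Definition lattice_point la := fun i : 'I_N.+1 => gbracket q t s (la i) i.

Lemma lattice_point_nodes la :
  [seq lattice_point la i | i <- enum 'I_N.+1] = nodes q t s la.
Proof.
rewrite nodesE size_tuple /mkseq -val_enum_ord -map_comp; apply: eq_map => i /=.
by rewrite /lattice_point -row_ord.
Qed.

Lemma partition_sorted la : is_partition la -> sorted geq la.
Proof.
move=> lap; apply/(sortedP 0%N) => i; rewrite size_tuple => iN.
by apply: (mu_row_le lap).
Qed.

Lemma tableau_poly_eval mu la : is_partition mu ->
  (tpoly mu).@[lattice_point la] = interp q t s (nodes q t s la) mu.
Proof.
move=> mu_part; have := interp_tableau_poly q t s mu_part (meval (lattice_point la)).
rewrite /= => ->; rewrite !mevalC -lattice_point_nodes; congr interp.
by apply: eq_map => i /=; rewrite mevalXU.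
Qed.

Lemma tableau_poly_vanish mu la : is_partition mu -> is_partition la ->
  ~~ (mu <= la)%MM -> (tpoly mu).@[lattice_point la] = 0.
Proof.
move=> mup lap; rewrite tableau_poly_eval //; apply: contraNeq => nz.
apply/mnm_lepP => i; rewrite -!row_ord.
exact: (interp_vanish (partition_sorted lap) nz).
Qed.

Lemma tableau_poly_diag_neq0 mu : is_partition mu -> (tpoly mu).@[lattice_point mu] != 0.
Proof.
move=> mup; rewrite tableau_poly_eval //.
exact: (interp_diag_neq0 gen s_gen (partition_sorted mup)).
Qed.

(** The leading exponent m of a symmetric polynomial is a partition; subtracting a multiple of
    [tpoly m] lowers the leading monomial. *)
Lemma symmetric_expansion p d : p \is symmetric -> (msize p <= d.+1)%N ->
  exists c : 'X_{1..N.+1} -> K,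
    (forall ka, c ka != 0 -> is_partition ka /\ (mdeg ka <= d)%N) /\
    p = \sum_(ka <- mnm_below N.+1 d.+1) c ka *: tpoly ka.
Proof.
move: p; suff H (m : 'X_{1..N.+1}) p : mlead p = m -> p \is symmetric -> (msize p <= d.+1)%N ->
  exists c : 'X_{1..N.+1} -> K,
    (forall ka, c ka != 0 -> is_partition ka /\ (mdeg ka <= d)%N) /\
    p = \sum_(ka <- mnm_below N.+1 d.+1) c ka *: tpoly ka.
  by move=> p; apply: (H (mlead p)).
elim/(well_founded_ind (@ltom_wf N.+1)): m p => m IH p pm p_sym p_size.
have [p0|p_neq0] := eqVneq p 0.
  exists (fun=> 0); split=> [ka|]; first by rewrite eqxx.
  by rewrite p0 big1 // => ka _; rewrite scale0r.
have mpart : is_partition m by rewrite -pm => i j; apply: mlead_msym_sorted.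
have md : (mdeg m <= d)%N by rewrite -ltnS -pm (leq_trans _ p_size) // -mlead_deg.
pose p' := p - mleadc p *: tpoly m.
have p'_sym : p' \is symmetric by rewrite rpredB // rpredZ // tableau_poly_sym.
have p'_coef k : p'@_k != 0 -> (k < m)%O.
  rewrite /p' mcoeffB mcoeffZ; case: (ltgtP k m) => // [mk|->].
    rewrite mcoeff_gt_mlead ?pm // sub0r oppr_eq0 mulf_eq0 negb_or => /andP[_].
    by move/(tableau_poly_le mpart); rewrite leNgt mk.
  by rewrite tableau_poly_coef // mulr1 -pm subrr eqxx.
have p'_size : (msize p' <= d.+1)%N.
  have [->|p'0] := eqVneq p' 0; first by rewrite msize0.
  rewrite -mlead_deg // ltnS (leq_trans _ md) // lemc_mdeg // ltW // p'_coef //.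
  by rewrite mleadc_eq0.
have [c [c_supp cE]] : exists c : 'X_{1..N.+1} -> K,
    (forall ka, c ka != 0 -> is_partition ka /\ (mdeg ka <= d)%N) /\
    p' = \sum_(ka <- mnm_below N.+1 d.+1) c ka *: tpoly ka.
  have [p'0|p'0] := eqVneq p' 0.
    exists (fun=> 0); split=> [ka|]; first by rewrite eqxx.
    by rewrite p'0 big1 // => ka _; rewrite scale0r.
  by apply: (IH (mlead p')) => //; apply: p'_coef; rewrite mleadc_eq0.
exists (fun ka => c ka + (if ka == m then mleadc p else 0)); split.
  move=> ka; have [-> _|_] := eqVneq ka m; first by split.
  by rewrite addr0; apply: c_supp.
under eq_bigr => ka _ do rewrite scalerDl.
rewrite big_split /= -cE (bigD1_seq m) ?mem_mnm_below ?mnm_below_uniq //= eqxx.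
rewrite [X in _ + (_ + X)]big1 ?addr0 ?subrK // => ka /negPf ->.
by rewrite scale0r.
Qed.

Lemma mdeg_lt_sub mu la : (mu <= la)%MM -> (mdeg la <= mdeg mu)%N -> mu = la.
Proof.
move=> /mnm_lepP h hd; apply/mnmP => i; apply/eqP; rewrite eqn_leq h /= leqNgt.
apply/negP => lt_i; move: hd; rewrite leqNgt => /negP; apply; rewrite !mdegE.
rewrite (bigD1 i) //= [X in (_ < X)%N](bigD1 i) //= -addSn leq_add //.
by apply: leq_sum => j _; apply: h.
Qed.

(** Triangularity: evaluated at the point of ka, the expansion of p keeps only ka and partitions
    strictly inside it, whose coefficients are 0 by induction on the size. *)
Lemma symmetric_eq0 p d : p \is symmetric -> (msize p <= d.+1)%N ->
  (forall la, is_partition la -> (mdeg la <= d)%N -> p.@[lattice_point la] = 0) -> p = 0.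
Proof.
move=> p_sym p_size p_eval; have [c [c_supp pE]] := symmetric_expansion p_sym p_size.
suff c0 ka : c ka = 0 by rewrite pE big1 // => ka _; rewrite c0 scale0r.
have [k] := ubnP (mdeg ka); elim: k ka => // k IH ka kak.
have [//|cka] := eqVneq (c ka) 0; have [kap kad] := c_supp _ cka.
have := p_eval ka kap kad;
  rewrite pE raddf_sum /= (bigD1_seq ka) ?mem_mnm_below ?mnm_below_uniq //=.
rewrite [X in _ + X]big1 ?addr0 => [|la la_neq].
  rewrite mevalZ => /eqP; rewrite mulf_eq0 (negPf (tableau_poly_diag_neq0 kap)) orbF.
  by move/eqP.
rewrite mevalZ; have [->|cla] := eqVneq (c la) 0; first by rewrite mul0r.
have [lap lad] := c_supp _ cla.
have [lala|nle] := boolP (la <= ka)%MM; last by rewrite tableau_poly_vanish ?mulr0.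
rewrite IH ?mul0r // -ltnS (leq_trans _ kak) // ltnS ltnNge; apply/negP => h.
by case/eqP: la_neq; apply: mdeg_lt_sub.
Qed.

(** Among the partitions of size at most |mu|, only mu contains mu, so p and a multiple of
    [tpoly mu] agree at all test points; the coefficient of x^mu fixes the multiple. *)
Lemma interpolation_unique mu p : is_partition mu -> p \is symmetric ->
  (msize p <= (mdeg mu).+1)%N -> p@_mu = 1 ->
  (forall la, is_partition la -> ~~ (mu <= la)%MM -> p.@[lattice_point la] = 0) ->
  p = tpoly mu.
Proof.
move=> mup p_sym p_size p_coef p_vanish.
have diag := tableau_poly_diag_neq0 mup.
pose c := p.@[lattice_point mu] / (tpoly mu).@[lattice_point mu].
have E : p = c *: tpoly mu.
  apply/eqP; rewrite -subr_eq0; apply/eqP; apply: (@symmetric_eq0 _ (mdeg mu)).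
  - by rewrite rpredB // rpredZ // tableau_poly_sym.
  - rewrite (leq_trans (msizeD_le _ _)) // geq_max p_size msizeN.
    by rewrite (leq_trans (msizeZ_le _ _)) // tableau_poly_size.
  move=> la lap lad; rewrite mevalB mevalZ.
  have [le|nle] := boolP (mu <= la)%MM; last first.
    by rewrite p_vanish // tableau_poly_vanish // mulr0 subr0.
  by rewrite -(mdeg_lt_sub le lad) /c divfK ?subrr.
suff c1 : c = 1 by rewrite E c1 scale1r.
by rewrite -p_coef E mcoeffZ tableau_poly_coef // mulr1.
Qed.

End Interpolation.

(** * The tableau formula for interpolation Macdonald polynomials *)

Theorem mainTheorem1 (n : nat) (mu : 'X_{1..n}) (I : {mpoly Qqts[n]}) :
  (1 <= n)%N -> is_partition mu ->
  is_interpolation_Macdonald mu I <->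
  I = \sum_(f : {ffun square mu -> 'I_n} | reverse_tableau f)
        Psi f *: \prod_(a : square mu)
          ('X_(f a)
           - (s * q ^+ sqcol a / t ^+ ((f a).+1 + sqrow a))%:MP
           - (t ^+ ((f a).+1 + sqrow a) / (s * q ^+ sqcol a))%:MP).
Proof.
case: n mu I => [//|N] mu I _ mu_part.
have gen := q_t_generic; have s_gen := s_generic.
set S := \sum_(f | _) _; have -> : S = tableau_poly q t s mu.
  apply: eq_bigr => f rt; congr (_ *: _); apply: eq_bigr => k _.
  (* [psi_psig] needs the last row of level k+1 to be empty; that level has at most N - k rows. *)
  rewrite psi_psig ?interl_level // -[k.+1](subKn (ltn_ord k)).
  by rewrite level_last // ?leq_subr // leq_subLR addSn ltnS leq_addl.
have bracketE (la : 'X_{1..N.+1}) : (fun i : 'I_N.+1 => bracket i.+1 (la i)) =1 lattice_point q t s la.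
  by move=> i; rewrite /bracket /lattice_point /gbracket invf_div.
split=> [[[I_neq0 I_sym I_size I_vanish] I_coef]|->].
  apply: (interpolation_unique gen s_gen) => // la la_part nle.
  by rewrite -(meval_eq _ (bracketE la)) I_vanish.
split; last exact: tableau_poly_coef gen mu_part.
split.
- exact: tableau_poly_neq0.
- exact: tableau_poly_sym.
- exact: tableau_poly_size.
by move=> la la_part nle; rewrite (meval_eq _ (bracketE la)) tableau_poly_vanish.
Qed.
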